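(* Let $p>3$ be a prime and let $w$ be a generator of the multiplicative group of $\mathbb F_p$. Then the following list is a system of representatives of the isomorphism classes of groups of order $p^4$ (every group of order $p^4$ is isomorphic to exactly one group of the list). For $1\le i\le 14$ only the nontrivial relations on the generators $g_1,g_2,g_3,g_4$ are given: $G_1$: $g_1^p=g_2,\ g_2^p=g_3,\ g_3^p=g_4$ (so $G_1\cong C_{p^4}$); $G_2$: $g_1^p=g_3,\ g_2^p=g_4$ (so $G_2\cong C_{p^2}\times C_{p^2}$); $G_3$: $[g_2,g_1]=g_3,\ g_1^p=g_4$; $G_4$: $[g_2,g_1]=g_4,\ g_1^p=g_3,\ g_2^p=g_4$; $G_5$: $g_1^p=g_3,\ g_3^p=g_4$ (so $G_5\cong C_{p^3}\times C_p$); $G_6$: $g_1^p=g_3,\ g_3^p=g_4,\ [g_2,g_1]=g_4$; $G_7$: $[g_2,g_1]=g_3,\ [g_3,g_1]=g_4$; $G_8$: $[g_2,g_1]=g_3,\ [g_3,g_1]=g_4,\ g_1^p=g_4$; $G_9$: $[g_2,g_1]=g_3,\ [g_3,g_1]=g_4,\ g_2^p=g_4$; $G_{10}$: $[g_2,g_1]=g_3,\ [g_3,g_1]=g_4,\ g_2^p=g_4^w$; $G_{11}$: $g_1^p=g_4$; $G_{12}$: $[g_2,g_1]=g_4$; $G_{13}$: $[g_2,g_1]=g_4,\ g_1^p=g_4$; $G_{14}$: $[g_2,g_1]=g_4,\ g_3^p=g_4$; $G_{15}=C_p^4$.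
   Context: $C_n$ is the cyclic group of order $n$; $[h,g]=h^{-1}g^{-1}hg$. Presentation convention: each listed group is defined by the power-commutator presentation on generators $g_1,\dots,g_4$ with the displayed relations together with all omitted trivial relations: $g_i^p=1$ for every $i$ for which no relation with left-hand side $g_i^p$ is displayed, and $[g_j,g_i]=1$ for every pair $j>i$ for which no relation with left-hand side $[g_j,g_i]$ is displayed. An exponent lying in $\mathbb F_p$ (such as $w$) is read as its integer representative in $\{0,\dots,p-1\}$. *)

(* Defs.v *)
From HB Require Import structures.
From mathcomp Require Import all_boot all_fingroup all_algebra all_solvable.

Set Implicit Arguments.
Unset Strict Implicit.
Unset Printing Implicit Defensive.

(* The entry of key k in the association list s, and 1 if there is none. *)
Definition rhs (K : eqType) (T : groupType) (s : seq (K * T)) (k : K) : T :=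
  nth 1%g (unzip2 s) (index k (unzip1 s)).

(* Relations of a power-commutator presentation on g 1, ..., g 4: the entry    *)
(* (i, a) of [pows] displays g_i^p = a and the entry (j, i, a) of [comms]      *)
(* displays [g_j, g_i] = a, where [~ x, y] = x^-1 y^-1 x y. Relations that are *)
(* not displayed are trivial. The values of g outside 1, ..., 4 are junk.      *)
Definition pc_relations (p : nat) (T : groupType) (g : nat -> T)
    (pows : seq (nat * T)) (comms : seq (nat * nat * T)) : Prop :=
  (forall i, 1 <= i <= 4 -> (g i ^+ p)%g = rhs pows i) /\
  (forall i j, [&& 1 <= i, i < j & j <= 4] -> [~ g j, g i]%g = rhs comms (j, i)).

Definition relations (p w k : nat) (T : groupType) (g : nat -> T) : Prop :=
  match k with
  |  1 => pc_relations p g [:: (1, g 2); (2, g 3); (3, g 4)] [::]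
  |  2 => pc_relations p g [:: (1, g 3); (2, g 4)] [::]
  |  3 => pc_relations p g [:: (1, g 4)] [:: (2, 1, g 3)]
  |  4 => pc_relations p g [:: (1, g 3); (2, g 4)] [:: (2, 1, g 4)]
  |  5 => pc_relations p g [:: (1, g 3); (3, g 4)] [::]
  |  6 => pc_relations p g [:: (1, g 3); (3, g 4)] [:: (2, 1, g 4)]
  |  7 => pc_relations p g [::] [:: (2, 1, g 3); (3, 1, g 4)]
  |  8 => pc_relations p g [:: (1, g 4)] [:: (2, 1, g 3); (3, 1, g 4)]
  |  9 => pc_relations p g [:: (2, g 4)] [:: (2, 1, g 3); (3, 1, g 4)]
  | 10 => pc_relations p g [:: (2, (g 4 ^+ w)%g)] [:: (2, 1, g 3); (3, 1, g 4)]
  | 11 => pc_relations p g [:: (1, g 4)] [::]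
  | 12 => pc_relations p g [::] [:: (2, 1, g 4)]
  | 13 => pc_relations p g [:: (1, g 4)] [:: (2, 1, g 4)]
  | 14 => pc_relations p g [:: (3, g 4)] [:: (2, 1, g 4)]
  |  _ => False
  end.

(* G is (isomorphic to) the group presented on four generators by R. The       *)
(* universal property ranges over all groups, finite or not, because           *)
(* [G \isog Grp ...] only says that G is the largest finite quotient of the    *)
(* presented group.                                                            *)
Definition presented_by (R : forall T : groupType, (nat -> T) -> Prop)
    (gT : finGroupType) (G : {group gT}) : Prop :=
  exists g : nat -> gT,
    [/\ <<[set g 1%N; g 2; g 3; g 4]>>%g = G,
        R gT g
      & forall (T : groupType) (h : nat -> T), R T h ->
          exists f : gT -> T,
            {in G &, {morph f : x y / (x * y)%g}} /\
            (forall i, 1 <= i <= 4 -> f (g i) = h i)].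

(* G is a copy of the k-th group of the list. *)
Definition is_listed (p w k : nat) (gT : finGroupType) (G : {group gT}) : Prop :=
  if k == 15 then (G \isog setXn (fun _ : 'I_4 => Zp p))%g : Prop
  else presented_by (relations p w k) G.

(* Main.v *)
Require Import Defs.
From HB Require Import structures.
From mathcomp Require Import all_boot all_fingroup all_algebra all_solvable.
From mathcomp Require Import finfield ring zify.

(** The relations of each of the fourteen presentations let one rewrite every
    word as g_1^a g_2^b g_3^c g_4^d with exponents below p ([pc_sequence]), so
    four elements satisfying them generate at most p^4 elements. When they
    generate exactly p^4, normal forms are unique, and a group T containing a
    solution h of the same relations receives a morphism: inside G * T the
    normal forms in the pairs (g_i, h_i) are closed under products, and they
    project bijectively to G, so they are the graph of a morphism
    ([pc_universal]). Hence a group of order p^4 generated by a solution of the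
    k-th relations ([satisfies]) is the k-th presented group, and any two such
    groups are isomorphic. Three things remain.

    Existence of a solution in every H of order p^4 other than C_p^4. The
    abelian case is the structure theorem. Otherwise the centre Z has order p or
    p^2. If |Z| = p^2, then H / Z is elementary of order p^2, [x, y] is
    bilinear with values of order p in Z, and x |-> x^p is a homomorphism from H
    to Z; the six groups are told apart by the structure of Z, the rank of this
    homomorphism and the position of its image with respect to H'
    ([class2_exists]). If |Z| = p, there is an abelian subgroup A of index p, and
    for x outside A the map D = [-, x] is a nilpotent endomorphism of A with
    kernel Z. Since |A| = p^3, D is a single Jordan block: a suitable y in A
    gives a chain y, [y, x], [[y, x], x] ending in a generator of Z. All p-th
    powers of x and y lie in Z, and (x a)^p = x^p a^p for a in A because p
    divides both 'C(p, 2) and 'C(p, 3), which is where p > 3 enters. Thus x can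
    be adjusted to x^p = 1 as soon as y^p <> 1. Replacing x by x^r multiplies the
    end of the chain by r^2, so the relation y^p = [[y, x], x]^b only matters
    modulo squares, which leaves b = 1 and b = w ([maxclass_exists]).

    Distinctness. [list_index] computes k from the isomorphism type by looking
    at commutativity, the position of H' and the exponents of H, Z and the
    centralizer of H'; the last two groups are separated by the solvability of
    y^p = [[y, x], x] <> 1, which for b = w would make w a square
    ([index_abelian], [index_class2], [index_maxclass]).

    Models of order p^4. All but C_{p^4}, C_p^4 and two products of two cyclic
    groups are obtained from one group law on pairs of residues and a module A
    of order p^2, with carries into A ([carry_group], [listed_model]). *)

Set Implicit Arguments.
Unset Strict Implicit.
Unset Printing Implicit Defensive.

Local Open Scope group_scope.

(** * Polycyclic sequences and their universal property *)

Section PcSequences.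

Variables (p : nat) (T : groupType).
Hypothesis p_gt1 : 1 < p.
Implicit Types (x y z : T) (s : seq T).

Fixpoint normal_form s (e : seq nat) : T :=
  if (s, e) is (x :: s', a :: e') then x ^+ a * normal_form s' e' else 1.

Fixpoint has_normal_form s : T -> Prop :=
  if s is x :: s' then
    fun y => exists2 a, a < p & exists2 z, has_normal_form s' z & y = x ^+ a * z
  else fun y => y = 1.

(** Commutators with x push every entry of s strictly further down the
    sequence, so conjugation by x preserves the set of normal forms in s. *)
Fixpoint pc_commutators s x : Prop :=
  if s is y :: s' then has_normal_form s' [~ y, x] /\ pc_commutators s' x else True.

(** The shape shared by all power-commutator presentations: p-th powers and
    commutators are expressed in later generators only. *)
Fixpoint pc_sequence s : Prop :=
  if s is x :: s' then
    [/\ has_normal_form s' (x ^+ p), pc_commutators s' x & pc_sequence s']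
  else True.

Lemma has_normal_formP s y :
  has_normal_form s y -> exists e : (size s).-tuple 'I_p,
    y = normal_form s (map val e).
Proof.
elim: s y => [|x s IHs] y /=; first by move=> ->; exists [tuple].
case=> a a_lt_p [z /IHs[e ->] ->].
by exists [tuple of Ordinal a_lt_p :: e].
Qed.

Lemma has_normal_form1 s : has_normal_form s 1.
Proof.
elim: s => //= x s IHs; exists 0; first exact: ltnW.
by exists 1; rewrite ?mulg1.
Qed.

Lemma has_normal_form_head x s : has_normal_form (x :: s) x.
Proof.
exists 1%N => //; exists 1; last by rewrite mulg1.
exact: has_normal_form1.
Qed.

Lemma has_normal_form_tail x s y :
  has_normal_form s y -> has_normal_form (x :: s) y.
Proof. by move=> sy; exists 0; [apply: ltnW | exists y; rewrite ?mul1g]. Qed.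

(** Both halves need each other: to multiply h^a y by h^b z one moves h^b to the
    left past y, which conjugates y, and then reduces h^(a+b) with h^p; to
    conjugate h^a y by x one needs powers of h [h, x], hence products. *)
Lemma pc_sequence_closed s : pc_sequence s ->
  (forall y z, has_normal_form s y -> has_normal_form s z ->
     has_normal_form s (y * z)) /\
  (forall x, pc_commutators s x ->
     forall y, has_normal_form s y -> has_normal_form s (y ^ x)).
Proof.
elim: s => [_|h s IHs] /=.
  by split=> [y z -> ->|x _ y ->]; rewrite ?mulg1 ?conj1g.
case=> hp sh /IHs[mul_s conj_s].
have mul_hs y z : has_normal_form (h :: s) y -> has_normal_form (h :: s) z ->
    has_normal_form (h :: s) (y * z).
  move=> /= [a a_p [y' sy' ->]] [b b_p [z' sz' ->]].
  have sy'b n : has_normal_form s (y' ^ (h ^+ n)).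
    by elim: n => [|n IHn]; rewrite ?conjg1 // expgSr conjgM; apply: conj_s.
  rewrite mulgA -(mulgA _ y') (conjgC y') mulgA -expgnDr -mulgA.
  have [ab_p | p_ab] := ltnP (a + b) p.
    by exists (a + b)%N => //; eexists; last by []; apply: (mul_s).
  exists (a + b - p)%N; first by rewrite ltn_subLR
    // (leq_ltn_trans (leq_add (ltnW a_p) (leqnn b))) // ltn_add2l.
  exists (h ^+ p * (y' ^ (h ^+ b) * z')); first by apply: (mul_s) => //; apply: (mul_s).
  by rewrite [RHS]mulgA -expgnDr subnK.
split=> // x [hx sx] y [a _ [z sz ->]].
rewrite conjMg conjXg; apply: (mul_hs); last exact/has_normal_form_tail/conj_s.
have hhx : has_normal_form (h :: s) (h ^ x).
  rewrite -(mulKVg h (h ^ x)) -commgEl.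
  by apply: mul_hs; [apply: has_normal_form_head | apply: has_normal_form_tail].
by elim: a => [|n IHn]; [apply: has_normal_form1 | rewrite expgS; apply: mul_hs].
Qed.

Lemma has_normal_formM s y z : pc_sequence s ->
  has_normal_form s y -> has_normal_form s z -> has_normal_form s (y * z).
Proof. by case/pc_sequence_closed=> mul_s _; apply: mul_s. Qed.

Lemma has_normal_formX s y n : pc_sequence s ->
  has_normal_form s y -> has_normal_form s (y ^+ n).
Proof.
move=> pc_s sy; elim: n => [|n IHn]; first exact: has_normal_form1.
by rewrite expgS; apply: has_normal_formM.
Qed.

End PcSequences.

Arguments has_normal_form p T s y : simpl never.

(** The direct product of two groups that need not be finite, under an alias
    that keeps it apart from the product of finite groups. *)
Definition pair_group (T1 T2 : groupType) : Type := (T1 * T2)%type.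
Section PairGroup.
Variables T1 T2 : groupType.
HB.instance Definition _ := Choice.on (pair_group T1 T2).
Let mul (u v : pair_group T1 T2) : pair_group T1 T2 := (u.1 * v.1, u.2 * v.2).
Let one : pair_group T1 T2 := (1, 1).
Let inv (u : pair_group T1 T2) : pair_group T1 T2 := (u.1^-1, u.2^-1).
Fact pair_mulA : associative mul.
Proof. by move=> u v w; congr pair; apply: mulgA. Qed.
Fact pair_mul1g : left_id one mul.
Proof. by case=> x y; congr pair; apply: mul1g. Qed.
Fact pair_mulg1 : right_id one mul.
Proof. by case=> x y; congr pair; apply: mulg1. Qed.
Fact pair_mulV : left_inverse one inv mul.
Proof. by case=> x y; congr pair; apply: mulVg. Qed.
Fact pair_Vmul : right_inverse one inv mul.
Proof. by case=> x y; congr pair; apply: mulgV. Qed.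
HB.instance Definition _ := isGroup.Build (pair_group T1 T2)
  pair_mulA pair_mul1g pair_mulg1 pair_mulV pair_Vmul.

Lemma pair_expg x y n : ((x, y) : pair_group T1 T2) ^+ n = (x ^+ n, y ^+ n).
Proof. by elim: n => // n IHn; rewrite !expgS IHn. Qed.
Lemma pair_commg x y x' y' :
  [~ (x, y) : pair_group T1 T2, (x', y')] = ([~ x, x'], [~ y, y']).
Proof. by []. Qed.

End PairGroup.

Section Universal.
Variables (p : nat) (gT : finGroupType) (T : groupType) (G : {group gT}).
Hypothesis p_gt1 : 1 < p.
Variables (s : seq (pair_group gT T)).
Hypotheses (pc_s : pc_sequence p s) (gen_s : <<[set x in map fst s]>> = G).
Hypothesis oG : #|G| = (p ^ size s)%N.

Let nf (e : (size s).-tuple 'I_p) := normal_form s (map val e).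

Fact normal_form_mem r e :
  all (ltn^~ p) e -> size e = size r -> pc_sequence p r ->
  has_normal_form p r (normal_form r e : pair_group gT T).
Proof.
elim: r e => [|u r IHr] [|a e] //= /andP[a_p e_p] [sz] [_ _ pc_r].
by exists a => //; exists (normal_form r e); rewrite //; apply: IHr.
Qed.

(** The first components of the normal forms in s make up a group of at most
    p^n elements containing G, so they determine the normal form, and with it
    the second component. The resulting function is a morphism because normal
    forms of pairs are closed under products. *)
Lemma pc_universal : exists f : gT -> T,
  {in G &, {morph f : x y / x * y}} /\ forall u, u \in s -> f u.1 = u.2.
Proof.
have nfP e : has_normal_form p s (nf e).
  apply: normal_form_mem; rewrite ?size_map ?size_tuple //.
  by rewrite all_map; apply/allP=> i _ /=; apply: ltn_ord.
pose K := [set (nf e).1 | e : (size s).-tuple 'I_p].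
have KP x t : has_normal_form p s (x, t) -> exists2 e, x = (nf e).1 & t = (nf e).2.
  by case/has_normal_formP=> e def_xt; exists e; rewrite /nf -def_xt.
have memK x t : has_normal_form p s (x, t) -> x \in K.
  by case/KP=> e -> _; apply: imset_f.
have gK : group_set K.
  apply/group_setP; split=> [|_ _ /imsetP[e _ ->] /imsetP[e' _ ->]].
    exact/(memK _ 1)/has_normal_form1.
  apply: (memK _ ((nf e).2 * (nf e').2)).
  by have := has_normal_formM p_gt1 pc_s (nfP e) (nfP e').
have s_nf u : u \in s -> has_normal_form p s u.
  elim: (s) => //= v r IHr; rewrite inE => /predU1P[->|/IHr].
    exact: has_normal_form_head.
  exact: has_normal_form_tail.
have sGK : G \subset group gK.
  rewrite -gen_s gen_subG; apply/subsetP=> x; rewrite inE => /mapP[[y t] /s_nf ys ->].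
  exact: memK ys.
have inj_nf : injective (fun e => (nf e).1).
  have: #|K| == #|{: (size s).-tuple 'I_p}|.
    rewrite eqn_leq leq_imset_card card_tuple card_ord -oG; exact: subset_leq_card.
  by move/imset_injP=> inj e e' eq_ee'; apply: inj eq_ee'; rewrite inE.
pose f x := if [pick e | (nf e).1 == x] is Some e then (nf e).2 else 1.
have fP x t : has_normal_form p s (x, t) -> f x = t.
  case/KP=> e -> ->; rewrite /f; case: pickP => [e' /eqP/inj_nf-> //|/(_ e)].
  by rewrite eqxx.
have sf x : x \in G -> has_normal_form p s (x, f x).
  move/(subsetP sGK)=> /imsetP[e _ ->].
  have := nfP e; case def_e: (nf e) => [y t] /= yt_nf.
  by rewrite (fP _ _ yt_nf).
exists f; split=> [x y Gx Gy | [x t] /s_nf/fP //].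
by apply: fP; have := has_normal_formM p_gt1 pc_s (sf _ Gx) (sf _ Gy).
Qed.

End Universal.

(** * The fourteen systems of relations *)

Lemma pc_relationsP p (T : groupType) (g : nat -> T) pows comms :
  pc_relations p g pows comms <->
    [/\ g 1%N ^+ p = rhs pows 1%N, g 2 ^+ p = rhs pows 2,
        g 3 ^+ p = rhs pows 3 & g 4 ^+ p = rhs pows 4] /\
    [/\ [~ g 2, g 1%N] = rhs comms (2, 1%N), [~ g 3, g 1%N] = rhs comms (3, 1%N)
      & [~ g 4, g 1%N] = rhs comms (4, 1%N)] /\
    [/\ [~ g 3, g 2] = rhs comms (3, 2), [~ g 4, g 2] = rhs comms (4, 2)
      & [~ g 4, g 3] = rhs comms (4, 3)].
Proof.
split=> [[Rp Rc] | [[? ? ? ?] [[? ? ?] [? ? ?]]]].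
  by do 2?split; rewrite ?Rp ?Rc.
split=> [i | i j]; first by do 5?[case: i => [|i] //].
do 5?[case: i => [|i] //]; do 5?[case: j => [|j] //]; by rewrite /= andbF.
Qed.

Lemma relations_pc_sequence p w k (T : groupType) (g : nat -> T) : 1 < p ->
  relations p w k g -> pc_sequence p [:: g 1%N; g 2; g 3; g 4].
Proof.
move=> p_gt1; do 15?[case: k => [|k] //]; move/pc_relationsP; rewrite /rhs /=;
  case=> [[R1 R2 R3 R4]] [[R21 R31 R41] [R32 R42 R43]];
  rewrite R1 R2 R3 R4 R21 R31 R41 R32 R42 R43; do ![split => //];
  repeat first [exact: p_gt1 | exact: has_normal_form1
    | exact: has_normal_form_head
    | lazymatch goal with |- has_normal_form _ _ (_ ^+ w) =>
        apply: has_normal_formX end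
    | apply: has_normal_form_tail
    | progress rewrite ?R3 ?R4 ?R43 | split].
Qed.

(** Generators and relations without the universal property, which is automatic
    at order p^4 by [satisfies_presented]. *)
Definition satisfies (p w k : nat) (gT : finGroupType) (G : {group gT}) : Prop :=
  exists g : nat -> gT,
    <<[set g 1%N; g 2; g 3; g 4]>> = G /\ relations p w k g.

Lemma relations_pair p w k (T1 T2 : groupType) (g : nat -> T1) (h : nat -> T2) :
    relations p w k g -> relations p w k h ->
  relations p w k (fun i => (g i, h i) : pair_group T1 T2).
Proof.
do 15?[case: k => [|k] //]; move=> /pc_relationsP + /pc_relationsP;
  rewrite /rhs /= => -[[R1 R2 R3 R4]] [[R21 R31 R41] [R32 R42 R43]];
  move=> -[[S1 S2 S3 S4]] [[S21 S31 S41] [S32 S42 S43]];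
  apply/pc_relationsP; rewrite /rhs /= !pair_expg !pair_commg;
  rewrite R1 R2 R3 R4 R21 R31 R41 R32 R42 R43;
  rewrite S1 S2 S3 S4 S21 S31 S41 S32 S42 S43; by do !split.
Qed.

Lemma satisfies_universal p w k (gT : finGroupType) (G : {group gT})
    (T : groupType) (g : nat -> gT) (h : nat -> T) :
    prime p -> #|G| = (p ^ 4)%N -> <<[set g 1%N; g 2; g 3; g 4]>> = G ->
    relations p w k g -> relations p w k h ->
  exists f : gT -> T, {in G &, {morph f : x y / x * y}} /\
    (forall i, 1 <= i <= 4 -> f (g i) = h i).
Proof.
move=> p_pr oG defG Rg Rh; have p_gt1 := prime_gt1 p_pr.
have pc_s := relations_pc_sequence p_gt1 (relations_pair Rg Rh).
have [|//|f [fM fs]] := pc_universal p_gt1 pc_s (G := G).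
  rewrite -defG; congr <<_>>; apply/setP=> x; by rewrite !inE -!orbA.
exists f; split=> // i i14; apply: (fs (g i, h i)).
by do 5?[case: i i14 => [|i] i14 //]; rewrite !in_cons eqxx ?orbT.
Qed.

Lemma satisfies_presented p w k (gT : finGroupType) (G : {group gT}) :
    prime p -> #|G| = (p ^ 4)%N -> satisfies p w k G ->
  presented_by (relations p w k) G.
Proof.
move=> p_pr oG [g [defG Rg]]; exists g; split=> // T h Rh.
exact: satisfies_universal Rh.
Qed.

Lemma gen4_mem (gT : finGroupType) (G : {group gT}) (g : nat -> gT) i :
  <<[set g 1%N; g 2; g 3; g 4]>> = G -> 1 <= i <= 4 -> g i \in G.
Proof.
move=> <- i14; rewrite mem_gen //.
by do 5?[case: i i14 => [|i] i14 //]; rewrite !inE eqxx ?orbT.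
Qed.

(** The morphism given by the universal property of G maps onto H, and the two
    orders agree. *)
Lemma satisfies_isog p w k (gT rT : finGroupType) (G : {group gT}) (H : {group rT}) :
    prime p -> #|G| = (p ^ 4)%N -> #|H| = (p ^ 4)%N ->
  satisfies p w k G -> satisfies p w k H -> G \isog H.
Proof.
move=> p_pr oG oH [g [defG Rg]] [h [defH Rh]].
have [f [fM fg]] := satisfies_universal p_pr oG defG Rg Rh.
pose phi := Morphism fM.
have imG : phi @* G = H.
  have Gg := (fun i => @gen4_mem _ _ g i defG).
  have <- : phi @* <<[set g 1%N; g 2; g 3; g 4]>> = phi @* G by rewrite defG.
  rewrite morphim_gen; last by rewrite -gen_subG defG.
  by rewrite !morphimU !morphim_set1 ?Gg //= !fg.
apply/isogP; exists phi => //.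
by rewrite -card_im_injm imG oG oH.
Qed.

Lemma isog_satisfies p w k (gT rT : finGroupType) (G : {group gT}) (H : {group rT}) :
  G \isog H -> satisfies p w k G -> satisfies p w k H.
Proof.
case/isogP=> f injf imG [g [defG Rg]].
have Gg := (fun i => @gen4_mem _ _ g i defG).
exists (fun i => f (g i)); split.
  have <- : f @* <<[set g 1%N; g 2; g 3; g 4]>> = H by rewrite defG.
  rewrite morphim_gen; last by rewrite -gen_subG defG.
  by rewrite !morphimU !morphim_set1 ?Gg.
have fX i n : 1 <= i <= 4 -> f (g i) ^+ n = f (g i ^+ n) by move/Gg/morphX->.
have fR i j : 1 <= i <= 4 -> 1 <= j <= 4 -> [~ f (g i), f (g j)] = f [~ g i, g j].
  by move=> /Gg Gi /Gg Gj; rewrite morphR.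
case: k Rg => [[]|k]; do 14?[case: k => [|k]].
15: by case.
all: move/pc_relationsP; rewrite /rhs /= => -[[R1 R2 R3 R4]].
all: case=> [[R21 R31 R41] [R32 R42 R43]]; apply/pc_relationsP.
all: rewrite /rhs /=; split; [|split]; split.
all: by rewrite [LHS](fX, fR) // (R1, R2, R3, R4, R21, R31, R41, R32, R42, R43)
  ?morph1 // -fX.
Qed.

(** * Generators and power maps in p-groups *)

(** In the abelian subgroup generated by a, b = [a, x] and c = [b, x],
    conjugation by x is the unipotent map 1 + D with D a = b, D b = c, D c = 0.
    Collecting the x's multiplies a by the sum of the first n powers of 1 + D,
    whose coefficients are binomial. *)
Lemma expMg_class3 (T : groupType) (x a : T) (b := [~ a, x]) (c := [~ b, x]) n :
    commute c x -> commute a b -> commute a c -> commute b c ->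
  (x * a) ^+ n = x ^+ n * (a ^+ n * b ^+ 'C(n, 2) * c ^+ 'C(n, 3)).
Proof.
move=> ccx cab cac cbc.
have conj_a : a ^ x = a * b by rewrite /b commgEl mulKVg.
have conj_b : b ^ x = b * c by rewrite /c commgEl mulKVg.
have conj_c : c ^ x = c by rewrite conjgE ccx mulKg.
elim: n => [|n IHn]; first by rewrite !mulg1.
rewrite expgSr IHn -[LHS]mulgA (mulgA _ x a) (conjgC _ x) !conjMg !conjXg.
rewrite conj_a conj_b conj_c (expgMn _ cab) (expgMn _ cbc).
have -> : a ^+ n * b ^+ n * (b ^+ 'C(n, 2) * c ^+ 'C(n, 2)) * c ^+ 'C(n, 3) =
    a ^+ n * (b ^+ 'C(n.+1, 2) * c ^+ 'C(n.+1, 3)).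
  by rewrite !binS bin1 addnC (addnC 'C(n, 3)) !expgnDr !mulgA.
have cabc : commute a (b ^+ 'C(n.+1, 2) * c ^+ 'C(n.+1, 3)).
  by apply: commuteM; apply: commuteX.
by rewrite -(mulgA x) -(mulgA (a ^+ n)) -cabc !expgSr !mulgA.
Qed.

Section PrimePower.
Variables (gT : finGroupType) (p : nat).
Hypothesis p_pr : prime p.
Implicit Types (G H M : {group gT}) (x y z : gT).

Lemma leq_mul_card_proper G M :
  p.-group G -> M \proper G -> (p * #|M| <= #|G|)%N.
Proof.
move=> pG /andP[sMG not_sGM]; rewrite -(Lagrange sMG) mulnC leq_mul2l.
apply/orP; right.
have [e def_e] := p_natP (pnat_dvd (dvdn_indexg G M) pG).
case: e def_e => [/eqP|e ->]; first by rewrite indexg_eq1 (negPf not_sGM).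
by rewrite expnS leq_pmulr // expn_gt0 prime_gt0.
Qed.

(** Each of the four elements enlarges the subgroup generated so far by a factor
    of at least p, since it leaves the next term of the chain. *)
Lemma gen4_chain H M2 M3 M4 x1 x2 x3 x4 : #|H| = (p ^ 4)%N ->
    M4 \subset M3 -> M3 \subset M2 -> M2 \subset H ->
    x1 \in H :\: M2 -> x2 \in M2 :\: M3 -> x3 \in M3 :\: M4 ->
    x4 \in M4 :\ 1 -> <<[set x1; x2; x3; x4]>> = H.
Proof.
move=> oH s43 s32 s2H; rewrite !inE.
move=> /andP[nx1 x1H] /andP[nx2 x2M] /andP[nx3 x3M] /andP[nx4 x4M].
have pH : p.-group H by rewrite /pgroup oH pnatX pnat_id.
have s3H := subset_trans s32 s2H; have s4H := subset_trans s43 s3H.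
pose K4 := <<[set x4]>>%G; pose K3 := <<[set x3; x4]>>%G.
pose K2 := <<[set x2; x3; x4]>>%G; pose K1 := <<[set x1; x2; x3; x4]>>%G.
have x4M3 := subsetP s43 _ x4M; have x4M2 := subsetP s32 _ x4M3.
have x3M2 := subsetP s32 _ x3M.
have sK4 : K4 \subset M4 by rewrite gen_subG sub1set.
have sK3 : K3 \subset M3 by rewrite gen_subG !subUset !sub1set x3M.
have sK2 : K2 \subset M2 by rewrite gen_subG !subUset !sub1set x2M x3M2.
have sK1 : K1 \subset H.
  by rewrite gen_subG !subUset !sub1set x1H !(subsetP s2H).
have step (A B : {group gT}) x : A \subset B -> B \subset H -> x \in B ->
    x \notin A -> (p * #|A| <= #|B|)%N.
  move=> sAB sBH Bx nAx; apply: leq_mul_card_proper; first exact: pgroupS pH.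
  by rewrite properE sAB; apply: contra nAx => /subsetP->.
have h4 : (p <= #|K4|)%N.
  rewrite -(muln1 p) -(cards1 (1 : gT)); apply: (step 1%G _ x4).
  - exact: sub1G.
  - exact: subset_trans sK4 _.
  - by rewrite mem_gen ?inE.
  - by rewrite inE.
have h3 : (p * #|K4| <= #|K3|)%N.
  apply: (step _ _ x3).
  - by apply: genS; rewrite sub1set !inE eqxx orbT.
  - exact: subset_trans sK3 _.
  - by rewrite mem_gen // !inE eqxx.
  - by apply: contra nx3; apply: (subsetP sK4).
have h2 : (p * #|K3| <= #|K2|)%N.
  apply: (step _ _ x2).
  - by apply: genS; rewrite subUset !sub1set !inE !eqxx !orbT.
  - exact: subset_trans sK2 _.
  - by rewrite mem_gen // !inE eqxx.
  - by apply: contra nx2; apply: (subsetP sK3).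
have h1 : (p * #|K2| <= #|K1|)%N.
  apply: (step _ _ x1).
  - by apply: genS; rewrite !subUset !sub1set !inE !eqxx !orbT.
  - by [].
  - by rewrite mem_gen // !inE eqxx.
  - by apply: contra nx1; apply: (subsetP sK2).
apply/eqP; rewrite -[X in X == _]/(gval K1) eqEcard sK1 oH.
apply: leq_trans h1; rewrite expnS leq_mul2l; apply/orP; right.
apply: leq_trans h2; rewrite expnS leq_mul2l; apply/orP; right.
by apply: leq_trans h3; rewrite expnS leq_mul2l h4 orbT.
Qed.

Lemma order_eq_prime x : x ^+ p = 1 -> x != 1 -> #[x] = p.
Proof.
move=> xp1 nx; have : #[x] %| p by rewrite order_dvdn xp1.
case/primeP: p_pr => _ /[apply] /orP[|/eqP //].
by rewrite order_eq1 (negPf nx).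
Qed.

(** A cyclic group has one subgroup of order p. *)
Lemma cyclic_expg_gen G x y : cyclic G -> x \in G -> y \in G ->
  x ^+ p = 1 -> y ^+ p = 1 -> x != 1 -> exists j, y = x ^+ j.
Proof.
move=> cycG Gx Gy xp1 yp1 nx; have [-> | ny] := eqVneq y 1; first by exists 0%N.
apply/cycleP; suff -> : <[x]> = <[y]> by apply: cycle_id.
apply/eqP; rewrite (eq_subG_cyclic cycG) ?cycle_subG //.
by rewrite -!orderE !order_eq_prime.
Qed.

Lemma prime_cycle_gen x y : x ^+ p = 1 -> y \in <[x]> -> y != 1 ->
  exists j, x = y ^+ j.
Proof.
move=> xp1 xy ny; apply: (cyclic_expg_gen (cycle_cyclic x)) => //.
  exact: cycle_id.
by case/cycleP: xy => i ->; rewrite expgnAC xp1 expg1n.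
Qed.

Lemma cycle_expgp x y : x ^+ p = 1 -> y \in <[x]> -> y ^+ p = 1.
Proof. by move=> xp1 /cycleP[i ->]; rewrite expgnAC xp1 expg1n. Qed.

(** Modulo N the generators commute, so the quotient is abelian. *)
Lemma der1_gen_sub (S : {set gT}) G (N : {group gT}) : <<S>> = G -> N <| G ->
  {in S &, forall x y, [~ x, y] \in N} -> G^`(1) \subset N.
Proof.
move=> defG nsNG cSN; have [_ nNG] := andP nsNG.
have nNS : S \subset 'N(N) by rewrite -gen_subG defG.
apply: der1_min => //; rewrite -defG quotient_gen // abelian_gen.
apply/centsP=> _ /morphimP[x nx Sx ->] _ /morphimP[y ny Sy ->].
apply/commgP; rewrite -morphR //=; apply/eqP/coset_id; exact: cSN.
Qed.

Lemma expg_gen_sub (S : {set gT}) G (N : {group gT}) n : <<S>> = G ->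
    {in G &, {morph (fun x => x ^+ n) : x y / x * y}} ->
  {in S, forall x, x ^+ n \in N} -> {in G, forall x, x ^+ n \in N}.
Proof.
move=> defG expM SN x Gx.
have gK : group_set [set y in G | y ^+ n \in N].
  apply/group_setP; split=> [|y z]; first by rewrite inE group1 expg1n group1.
  by rewrite !inE => /andP[Gy Ny] /andP[Gz Nz]; rewrite expM ?groupM.
have : G \subset group gK.
  rewrite -{1}defG gen_subG; apply/subsetP=> y Sy; rewrite inE SN //.
  by rewrite -defG mem_gen.
by move/subsetP/(_ x Gx); rewrite inE => /andP[].
Qed.

Lemma commg_center G x y : x \in 'Z(G) -> y \in G -> [~ x, y] = 1.
Proof. by case/centerP=> _ cx Gy; apply/eqP/commgP; apply: cx. Qed.

Lemma center_commute G x y : x \in 'Z(G) -> y \in G -> commute x y.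
Proof. by case/centerP=> _ cx Gy; apply: cx. Qed.

Lemma noncentral_comm G x : x \in G -> x \notin 'Z(G) ->
  exists2 y, y \in G & [~ y, x] != 1.
Proof.
move=> Gx; case: (boolP [exists y in G, [~ y, x] != 1]) => [/exists_inP //|].
move=> cGx /negP[]; apply/centerP; split=> // y Gy.
apply/commute_sym/commgP; apply: contraNT cGx => nyx.
by apply/exists_inP; exists y.
Qed.

Lemma nonabelian_comm G : ~~ abelian G ->
  exists2 x, x \in G & exists2 y, y \in G & [~ y, x] != 1.
Proof.
rewrite /abelian => /subsetPn[x Gx nCx]; exists x => //.
apply: noncentral_comm => //; apply: contra nCx => /centerP[_ cx].
by apply/centP=> y; apply: cx.
Qed.

Section Class2.
Variable G : {group gT}.
Hypothesis sG'Z : G^`(1) \subset 'Z(G).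

Lemma commg_in_center x y : x \in G -> y \in G -> [~ x, y] \in 'Z(G).
Proof. by move=> Gx Gy; rewrite (subsetP sG'Z) // mem_commg. Qed.

Lemma class2_commXg x y n : x \in G -> y \in G -> [~ x ^+ n, y] = [~ x, y] ^+ n.
Proof.
move=> Gx Gy; apply: commXg; apply: commute_sym.
exact: (center_commute (commg_in_center Gx Gy)).
Qed.

Lemma class2_commgX x y n : x \in G -> y \in G -> [~ x, y ^+ n] = [~ x, y] ^+ n.
Proof.
move=> Gx Gy; apply: commgX; apply: commute_sym.
exact: (center_commute (commg_in_center Gx Gy)).
Qed.

Lemma class2_commMg x y u : x \in G -> y \in G -> u \in G -> [~ u, x] = 1 ->
  [~ y * u, x] = [~ y, x].
Proof.
move=> Gx Gy Gu ux1; rewrite commMgJ ux1 mulg1 conjgE.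
by rewrite (center_commute (commg_in_center Gy Gx)) ?mulKg.
Qed.

(** The correction term [y, x]^'C(p, 2) vanishes since p is odd. *)
Lemma class2_expgM : odd p -> {in G &, forall x y, [~ x, y] ^+ p = 1} ->
  {in G &, {morph (fun x => x ^+ p) : x y / x * y}}.
Proof.
move=> odd_p commp x y Gx Gy.
have cz z : z \in G -> commute z [~ y, x].
  by move=> Gz; apply/commute_sym/(center_commute _ Gz)/commg_in_center.
rewrite (expMg_Rmul p (cz _ Gy) (cz _ Gx)) bin2odd //.
by rewrite expgnA commp // expg1n mulg1.
Qed.

End Class2.

End PrimePower.

(** * Groups of order p^4 with centre of order p^2 *)

Definition quadruple (T : groupType) (x1 x2 x3 x4 : T) : nat -> T :=
  nth 1 [:: 1; x1; x2; x3; x4].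

Section Class2Existence.
Variables (gT : finGroupType) (p w : nat) (H : {group gT}).
Hypotheses (p_pr : prime p) (odd_p : odd p) (oH : #|H| = (p ^ 4)%N).
Hypotheses (nabH : ~~ abelian H) (oZ : #|'Z(H)| = (p ^ 2)%N).
Implicit Types x y z : gT.

Let pH : p.-group H. Proof. by rewrite /pgroup oH pnatX pnat_id. Qed.
Let Z := 'Z(H)%G.
Let sZH : Z \subset H := center_sub H.
Let p_gt1 := prime_gt1 p_pr.

Let oHZ : #|H / Z| = (p ^ 2)%N.
Proof.
by rewrite card_quotient ?gFnorm // -divgS // oH oZ -expnB // ltnW.
Qed.

Fact der1_sub_center : H^`(1) \subset 'Z(H).
Proof. by rewrite der1_min ?gFnorm // (card_p2group_abelian p_pr oHZ). Qed.

(** Otherwise a coset of Z would have order p^2, and H / Z would be cyclic. *)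
Fact expg_p_center x : x \in H -> x ^+ p \in 'Z(H).
Proof.
move=> Hx; have Nx : x \in 'N(Z) by rewrite (subsetP (gFnorm _ H)).
rewrite coset_idr ?groupX ?morphX //=; apply/eqP; rewrite -order_dvdn.
have : #[coset Z x] %| p ^ 2 by rewrite -oHZ order_dvdG ?mem_quotient.
case/(dvdn_pfactor _ _ p_pr)=> [[|[|[|//]]]] _ ox; rewrite ox ?dvd1n ?dvdnn //.
case/negP: nabH; apply: cyclic_center_factor_abelian; apply/cyclicP.
exists (coset Z x); apply/eqP.
by rewrite eq_sym eqEcard cycle_subG mem_quotient // -orderE ox oHZ leqnn.
Qed.

Let comm_Z x y : x \in H -> y \in H -> [~ x, y] \in 'Z(H).
Proof. exact: commg_in_center der1_sub_center _ _. Qed.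
Let ZH z : z \in 'Z(H) -> z \in H. Proof. exact: (subsetP sZH). Qed.

Fact class2_comm_expp x y : x \in H -> y \in H -> [~ x, y] ^+ p = 1.
Proof.
move=> Hx Hy; rewrite -(class2_commXg der1_sub_center) //.
by rewrite (commg_center (expg_p_center Hx)).
Qed.

Let expMp : {in H &, {morph (fun x => x ^+ p) : x y / x * y}}.
Proof. exact: class2_expgM der1_sub_center odd_p class2_comm_expp. Qed.

(** The chain is 1 < <[x4]> < Z < 'C_H[x2] < H. *)
Lemma class2_gen x1 x2 x3 x4 : x1 \in H -> x2 \in H -> [~ x2, x1] != 1 ->
    x3 \in 'Z(H) -> x4 \in 'Z(H) -> x4 != 1 -> x3 \notin <[x4]> ->
  <<[set x1; x2; x3; x4]>> = H.
Proof.
move=> H1 H2 c21 Z3 Z4 n4 n3.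
have s2H : 'C_H[x2] \subset H by apply: subsetIl.
apply: (gen4_chain (M2 := 'C_H[x2]%G) (M3 := Z) (M4 := <[x4]>%G) p_pr oH).
- by rewrite cycle_subG.
- apply/subsetP=> z Zz; rewrite inE ZH //=; apply/cent1P.
  exact: (center_commute Zz H2).
- by [].
- rewrite in_setD in_setI H1 andbT /=; apply: contra c21 => /cent1P c12.
  exact/commgP.
- apply/setDP; split; first by apply/setIP; rewrite H2 cent1id.
  by apply: contra c21 => Z2; rewrite (commg_center Z2).
- by apply/setDP; split.
- by rewrite in_setD1 n4 cycle_id.
Qed.

Lemma class2_satisfies k x1 x2 x3 x4 : x1 \in H -> x2 \in H ->
    [~ x2, x1] != 1 -> x3 \in 'Z(H) -> x4 \in 'Z(H) -> x4 != 1 ->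
    x3 \notin <[x4]> ->
  relations p w k (quadruple x1 x2 x3 x4) -> satisfies p w k H.
Proof.
move=> H1 H2 c21 Z3 Z4 n4 n3 Rk; exists (quadruple x1 x2 x3 x4); split=> //.
exact: class2_gen.
Qed.

Fact center_cyclic z : z \in 'Z(H) -> z ^+ p != 1 -> 'Z(H) = <[z]>.
Proof.
move=> Zz nzp; apply/eqP; rewrite eq_sym eqEcard cycle_subG Zz oZ /= -orderE.
have : #[z] %| p ^ 2 by rewrite -oZ order_dvdG.
case/(dvdn_pfactor _ _ p_pr)=> [[|[|[|//]]]] _ oz; last by rewrite oz.
  by case/eqP: nzp; apply/eqP; rewrite -order_dvdn oz dvd1n.
by case/eqP: nzp; apply/eqP; rewrite -order_dvdn oz dvdnn.
Qed.

(** The p-th power map is a morphism, so x can be corrected by a power of z. *)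
Lemma shift_expp z x : z \in H -> x \in H -> x ^+ p \in <[z ^+ p]> ->
  exists i, (x * z ^- i) ^+ p = 1.
Proof.
move=> Hz Hx /cycleP[i xp]; exists i; have HV : z ^- i \in H by rewrite groupV groupX.
by rewrite (expMp Hx HV) /= xp expgVn expgnAC mulgV.
Qed.

(** If some p-th power x^p generates Z, a noncommuting y can be corrected to
    y^p = 1 and scaled to [y, x] = x^(p^2): the sixth group. Otherwise all p-th
    powers lie in the subgroup of order p of Z, so two noncommuting elements can
    be corrected by central elements to have trivial p-th powers, with the same
    commutator: the fourteenth group. *)
Lemma class2_exists_cyclic z : z \in 'Z(H) -> z ^+ p != 1 ->
  exists2 k, 1 <= k <= 15 & satisfies p w k H.
Proof.
move=> Zz nzp; have defZ := center_cyclic Zz nzp.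
have cycZ : cyclic 'Z(H) by rewrite defZ cycle_cyclic.
have Zexp t : t \in 'Z(H) -> (t ^+ p) ^+ p = 1.
  move=> Zt; rewrite -expgnA; apply/eqP; rewrite -order_dvdn.
  by rewrite -[(p * p)%N]oZ order_dvdG.
have nZx4 t u : t ^+ p != 1 -> u ^+ p = 1 -> t \notin <[u]>.
  by move=> nt u1; apply: contra nt => /(cycle_expgp u1)->.
have [|Hpp] := boolP [exists x in H, (x ^+ p) ^+ p != 1].
  case/exists_inP=> x Hx nxpp; have defZx := center_cyclic (expg_p_center Hx) nxpp.
  have nZx : x \notin 'Z(H) by apply: contra nxpp => /Zexp->.
  have [y Hy cyx] := noncentral_comm Hx nZx.
    have yp : y ^+ p \in <[x ^+ p]> by rewrite -defZx expg_p_center.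
  have [i y1p] := shift_expp Hx Hy yp; set y1 := y * _ in y1p.
  have Hy1 : y1 \in H by rewrite groupM ?groupV ?groupX.
  have cy1x : [~ y1, x] = [~ y, x].
    rewrite (class2_commMg der1_sub_center) ?groupV ?groupX //.
    by apply/eqP/commgP/commute_sym/commuteV/commuteX.
  have [j c_j] : exists j, (x ^+ p) ^+ p = [~ y1, x] ^+ j.
    apply: (cyclic_expg_gen p_pr cycZ); rewrite ?comm_Z ?class2_comm_expp ?cy1x //.
      by rewrite groupX ?expg_p_center.
    exact/Zexp/expg_p_center.
  have c_y2 : [~ y1 ^+ j, x] = (x ^+ p) ^+ p.
    by rewrite (class2_commXg der1_sub_center).
  have Zxp := expg_p_center Hx; have xppp := Zexp _ Zxp.
  have Zxpp : (x ^+ p) ^+ p \in 'Z(H) by rewrite groupX.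
  exists 6 => //; apply: (@class2_satisfies 6 x (y1 ^+ j) (x ^+ p) ((x ^+ p) ^+ p));
    rewrite ?Zxp ?Zxpp ?c_y2 ?nZx4 ?(groupX j Hy1) //.
  apply/pc_relationsP; rewrite /rhs /quadruple /=.
  rewrite !(commg_center Zxp) ?(commg_center Zxpp) ?groupX ?(ZH Zxp) //.
  by rewrite expgnAC y1p expg1n.
have kill x : x \in H -> exists2 u, u \in 'Z(H) & (x * u) ^+ p = 1.
  move=> Hx; have [|i xp] := shift_expp (ZH Zz) Hx.
    have [||//|i ->] := cyclic_expg_gen p_pr cycZ (groupX p Zz) (expg_p_center Hx).
    - exact: Zexp.
    - apply/eqP; apply: contraNT Hpp => nxpp; by apply/exists_inP; exists x.
    - exact: mem_cycle.
  by exists (z ^- i); rewrite ?groupV ?groupX.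
have [x Hx [y Hy cyx]] := nonabelian_comm nabH.
have [u Zu xup] := kill x Hx; have [v Zv yvp] := kill y Hy.
have Hu := ZH Zu; have Hv := ZH Zv.
have cxu : [~ y * v, x * u] = [~ y, x].
  rewrite (class2_commMg der1_sub_center) ?groupM ?(commg_center Zv) ?groupM //.
  apply: invg_inj; rewrite !invg_comm.
  by rewrite (class2_commMg der1_sub_center) // (commg_center Zu).
have [j c_j] : exists j, [~ y, x] = (z ^+ p) ^+ j.
  apply: (cyclic_expg_gen p_pr cycZ); rewrite ?comm_Z ?class2_comm_expp ?groupX //.
  exact: Zexp.
have Zzj : z ^+ j \in 'Z(H) by rewrite groupX.
have zjp : (z ^+ j) ^+ p = [~ y, x] by rewrite expgnAC.
exists 14 => //.
apply: (@class2_satisfies 14 (x * u) (y * v) (z ^+ j) [~ y, x]);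
  rewrite ?(groupM Hx Hu) ?(groupM Hy Hv) ?cxu ?Zzj ?nZx4 ?class2_comm_expp ?zjp
    ?comm_Z //.
apply/pc_relationsP; rewrite /rhs /quadruple /= xup yvp zjp cxu class2_comm_expp //.
have Zc := comm_Z Hy Hx.
by rewrite !(commg_center Zzj, commg_center Zc) ?(groupM Hx Hu) ?(groupM Hy Hv) ?(ZH Zzj).
Qed.

(** The p-th power map factors through H / Z and has values in Z, both elementary
    of order p^2. Rank 0 gives the twelfth group; rank 1 the thirteenth or the
    third, according to whether the commutators lie in the image; rank 2 the
    fourth. *)
Lemma class2_exists_elementary : {in 'Z(H), forall z, z ^+ p = 1} ->
  exists2 k, 1 <= k <= 15 & satisfies p w k H.
Proof.
move=> Zexp.
have pick3 t : t \in 'Z(H) -> exists2 s, s \in 'Z(H) & s \notin <[t]>.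
  move=> Zt; apply/subsetPn; apply/negP=> /subset_leq_card.
  apply/negP; rewrite -ltnNge oZ -orderE (@leq_ltn_trans p) //.
    by rewrite dvdn_leq ?prime_gt0 // order_dvdn Zexp.
  by rewrite -{1}(expn1 p) ltn_exp2l.
have [|H1] := boolP [exists x in H, x ^+ p != 1]; last first.
  have Hexp x : x \in H -> x ^+ p = 1.
    by move=> Hx; apply/eqP; apply: contraNT H1 => nx; apply/exists_inP; exists x.
  have [x Hx [y Hy cyx]] := nonabelian_comm nabH.
  have Zc := comm_Z Hy Hx; have [s Zs ns] := pick3 _ Zc.
  exists 12 => //; apply: (@class2_satisfies 12 x y s [~ y, x]) => //.
  apply/pc_relationsP; rewrite /rhs /quadruple /= !Hexp ?(ZH Zs) ?(ZH Zc) //.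
  by rewrite !(commg_center Zs, commg_center Zc) ?(ZH Zs).
case/exists_inP=> x Hx nxp; have Zxp := expg_p_center Hx.
have nZx : x \notin 'Z(H) by apply: contra nxp => /Zexp->.
have [|rank1] := boolP [exists u in H, u ^+ p \notin <[x ^+ p]>]; last first.
  have [y0 Hy0 cy0x] := noncentral_comm Hx nZx.
  have [|i yp] := shift_expp Hx Hy0.
    by apply: contraNT rank1 => ny; apply/exists_inP; exists y0.
  set y := y0 * _ in yp.
  have Hy : y \in H by rewrite groupM ?groupV ?groupX.
  have cyx : [~ y, x] != 1.
    rewrite (class2_commMg der1_sub_center) ?groupV ?groupX //.
    by apply/eqP/commgP/commute_sym/commuteV/commuteX.
  have Zc := comm_Z Hy Hx.
  have [cx | ncx] := boolP ([~ y, x] \in <[x ^+ p]>).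
    have [j def_xp] := prime_cycle_gen p_pr (Zexp _ Zxp) cx cyx.
    have [s Zs ns] := pick3 _ Zxp.
    have cyj : [~ y ^+ j, x] = x ^+ p by rewrite (class2_commXg der1_sub_center).
    exists 13 => //; apply: (@class2_satisfies 13 x (y ^+ j) s (x ^+ p));
      rewrite ?cyj ?(groupX j Hy) //.
    apply/pc_relationsP; rewrite /rhs /quadruple /= cyj !(commg_center Zs,
      commg_center Zxp) ?(groupX j Hy) ?(ZH Zs) //.
    by rewrite expgnAC yp expg1n (Zexp _ Zs) (Zexp _ Zxp).
  exists 3 => //; apply: (@class2_satisfies 3 x y [~ y, x] (x ^+ p)) => //.
  apply/pc_relationsP; rewrite /rhs /quadruple /= yp (Zexp _ Zc) (Zexp _ Zxp).
  by rewrite !(commg_center Zc, commg_center Zxp) ?(ZH Zc).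
case/exists_inP=> u Hu nup.
have [v Hv [v' Hv' nc]] := nonabelian_comm nabH; set c := [~ v', v] in nc.
have Zc : c \in 'Z(H) by rewrite comm_Z.
(* The power map has rank 2, so the generator c of H' is a p-th power g^p. *)
have [s Zs ns] := pick3 _ Zc.
have sH'c : H^`(1) \subset <[c]>.
  apply: (der1_gen_sub (class2_gen Hv Hv' nc Zs Zc nc ns)).
    by rewrite sub_center_normal // cycle_subG.
  have cyc : [~ v, v'] \in <[c]> by rewrite -invg_comm groupV cycle_id.
  by move=> a b; rewrite !inE -!orbA => /or4P[] /eqP-> /or4P[] /eqP->;
    rewrite ?commgg ?cycle_id ?cyc // 1?(commg_center Zs, commg_center Zc) ?group1
      ?(ZH Zs) ?(ZH Zc) // -invg_comm (commg_center Zs, commg_center Zc) ?invg1 ?group1.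
pose phi := Morphism expMp.
have phiZ : phi @* H = 'Z(H).
  apply/eqP; rewrite eqEcard; apply/andP; split.
    by apply/subsetP=> _ /morphimP[h Hh _ ->]; apply: expg_p_center.
  rewrite oZ; have phi_x : x ^+ p \in phi @* H by apply: (mem_morphim phi Hx Hx).
  have -> : (p ^ 2 = p * #|<[(x ^+ p)%g]>|)%N.
    by rewrite -orderE (order_eq_prime p_pr (Zexp _ Zxp) nxp).
  apply: (leq_mul_card_proper p_pr); first exact: morphim_pgroup.
  rewrite properE cycle_subG phi_x /=; apply/subsetPn; exists (u ^+ p) => //.
  exact: (mem_morphim phi Hu Hu).
have : c \in phi @* H by rewrite phiZ.
case/morphimP=> g Hg _ /= def_c.
have nZg : g \notin 'Z(H) by apply: contra nc => /Zexp <-; rewrite def_c.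
have [f0 Hf0 cf0g] := noncentral_comm Hg nZg.
have cgf0 : [~ g, f0] != 1 by rewrite -invg_comm eq_invg1.
have [j c_j] : exists j, c = [~ g, f0] ^+ j.
  apply: (prime_cycle_gen p_pr) => //; first exact: Zexp.
  by rewrite (subsetP sH'c) // mem_commg.
pose f := f0 ^+ j; have Hf : f \in H by rewrite groupX.
have cgf : [~ g, f] = c by rewrite (class2_commgX der1_sub_center).
(* As f and g generate H modulo Z, f^p in <[c]> would bring the rank down to 1. *)
have nfp : f ^+ p \notin <[c]>.
  apply/negP=> fpc.
  have Hpc : {in H, forall h, h ^+ p \in <[c]>}.
    have ncgf : [~ g, f] != 1 by rewrite cgf.
    apply: (expg_gen_sub (class2_gen Hf Hg ncgf Zs Zc nc ns) expMp).
    move=> a; rewrite !inE -!orbA => /or4P[] /eqP-> //.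
    - by rewrite -def_c cycle_id.
    - by rewrite Zexp.
    - by rewrite Zexp.
  have [i cxi] := prime_cycle_gen p_pr (Zexp _ Zc) (Hpc x Hx) nxp.
  case/negP: nup; apply: subsetP (Hpc u Hu).
  by rewrite cycle_subG cxi mem_cycle.
exists 4 => //; have Zfp := expg_p_center Hf.
apply: (@class2_satisfies 4 f g (f ^+ p) c); rewrite ?cgf //.
apply/pc_relationsP; rewrite /rhs /quadruple /= cgf -def_c (Zexp _ Zc) (Zexp _ Zfp).
by rewrite !(commg_center Zfp, commg_center Zc) ?(ZH Zfp).
Qed.

Lemma class2_exists : exists2 k, 1 <= k <= 15 & satisfies p w k H.
Proof.
have [|Zexp] := boolP [exists z in 'Z(H), z ^+ p != 1].
  by case/exists_inP=> z; apply: class2_exists_cyclic.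
apply: class2_exists_elementary => z Zz; apply/eqP.
by apply: contraNT Zexp => nz; apply/exists_inP; exists z.
Qed.

End Class2Existence.

(** * Groups of order p^4 with centre of order p *)

(** Conjugation by x^n is (1 + D)^n in the notation of [expMg_class3]. *)
Lemma comm_expg_class3 (T : groupType) (a x : T) (b := [~ a, x]) (c := [~ b, x]) n :
    commute c x -> commute b c ->
  [~ a, x ^+ n] = b ^+ n * c ^+ 'C(n, 2) /\ [~ b, x ^+ n] = c ^+ n.
Proof.
move=> ccx cbc.
have conj_a : a ^ x = a * b by rewrite /b commgEl mulKVg.
have conj_b : b ^ x = b * c by rewrite /c commgEl mulKVg.
have conj_c : c ^ x = c by rewrite conjgE ccx mulKg.
have conj_bn m : b ^ (x ^+ m) = b * c ^+ m.
  elim: m => [|m IHm]; first by rewrite conjg1 mulg1.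
  by rewrite expgSr conjgM IHm conjMg conjXg conj_b conj_c expgS -mulgA.
split; last by rewrite commgEl conj_bn mulKg.
suff conj_an : a ^ (x ^+ n) = a * (b ^+ n * c ^+ 'C(n, 2)).
  by rewrite commgEl conj_an mulKg.
elim: n => [|n IHn]; first by rewrite conjg1 !mulg1.
rewrite expgSr conjgM IHn !conjMg !conjXg conj_a conj_b conj_c (expgMn _ cbc).
by rewrite binS bin1 addnC expgnDr expgS !mulgA.
Qed.

Section MaxClass.
Variables (gT : finGroupType) (p w : nat) (H : {group gT}).
Hypotheses (p_pr : prime p) (p_gt3 : 3 < p) (oH : #|H| = (p ^ 4)%N).
Hypotheses (oZ : #|'Z(H)| = p).
Implicit Types x y z : gT.

Let pH : p.-group H. Proof. by rewrite /pgroup oH pnatX pnat_id. Qed.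
Let ZH z : z \in 'Z(H) -> z \in H. Proof. exact: (subsetP (center_sub H)). Qed.

Let center_exp z : z \in 'Z(H) -> z ^+ p = 1.
Proof. by move=> Zz; apply/eqP; rewrite -order_dvdn -oZ order_dvdG. Qed.

(** A is the centralizer of a noncentral t in a normal subgroup N of order p^2.
    The conjugates of t lie in t [N, H] and |[N, H]| <= p, so A has index p;
    and 'Z(A) contains both Z and t, so A / 'Z(A) is cyclic. *)
Lemma maxclass_abelian_subgroup : exists A : {group gT},
  [/\ A \subset H, abelian A & #|A| = (p ^ 3)%N].
Proof.
have p_gt1 := prime_gt1 p_pr; have nilH := pgroup_nil pH.
have [|N [sNH nsNH oN]] := @normal_pgroup p _ 2 H H pH (normal_refl H).
  by rewrite oH pfactorK.
have [t Nt nZt] : exists2 t, t \in N & t \notin 'Z(H).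
  apply/subsetPn/negP=> /subset_leq_card; apply/negP.
  by rewrite -ltnNge oN oZ -{1}(expn1 p) ltn_exp2l.
have Ht := subsetP sNH _ Nt.
have ntN : N :!=: 1 by rewrite -cardG_gt1 oN (ltn_exp2l 0).
have oR : #|[~: N, H]| <= p.
  have := nil_comm_properl nilH sNH ntN (A := H); rewrite subsetI subxx normal_norm //.
  move/(_ isT)/(leq_mul_card_proper p_pr (pgroupS sNH pH)).
  by rewrite oN leq_pmul2l // prime_gt0.
pose A := 'C_H[t]%G; have sAH : A \subset H := subsetIl _ _.
have iA : #|H : A| <= p.
  rewrite index_cent1; apply: leq_trans oR; rewrite -(card_lcoset [~: N, H] t).
  apply/subset_leq_card/subsetP=> _ /imsetP[h Hh ->]; apply/lcosetP.
  by exists [~ t, h]; rewrite ?mem_commg // commgEl mulKVg.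
have oA : #|A| = (p ^ 3)%N.
  have oAi : (#|A| * #|H : A| = p ^ 4)%N by rewrite Lagrange.
  have : p.-nat #|H : A| := pnat_dvd (dvdn_indexg H A) pH.
  case/p_natP=> [[|[|i]]] iE; rewrite iE in oAi iA.
  - case/negP: nZt; move/eqP: iE; rewrite indexg_eq1 => sHA.
    apply/centerP; split=> // h /(subsetP sHA)/setIP[_ /cent1P //].
  - by apply/eqP; rewrite -(eqn_pmul2r (prime_gt0 p_pr)) -expnSr -oAi expn1.
  - by move: iA; rewrite leqNgt -{1}(expn1 p) ltn_exp2l.
exists A; split=> //.
have sZA : 'Z(H) \subset A.
  by apply/subsetP=> z Zz; apply/setIP; split;
    [apply: ZH | apply/cent1P/(center_commute Zz)].
have sZZA : 'Z(H) \subset 'Z(A).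
  apply/subsetP=> z Zz; apply/centerP; split; first exact: (subsetP sZA).
  by move=> a /(subsetP sAH); apply: center_commute.
have ZAt : t \in 'Z(A).
  by apply/centerP; split=> [|a /setIP[_ /cent1P]]; first by apply/setIP; rewrite cent1id.
have oZA : (p * p <= #|'Z(A)|)%N.
  rewrite -{2}oZ (leq_mul_card_proper p_pr) ?(pgroupS _ pH) //.
    exact: subset_trans (center_sub A) sAH.
  by rewrite properE sZZA; apply: contra nZt => /subsetP->.
apply: cyclic_center_factor_abelian.
have: p.-group (A / 'Z(A)) by rewrite quotient_pgroup // (pgroupS sAH).
case/p_natP=> [[|[|i]]] oq.
- by rewrite (card1_trivg oq) cyclic1.
- by rewrite prime_cyclic // oq.
have : (#|'Z(A)| * #|A / 'Z(A)| = p ^ 3)%N.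
  by rewrite card_quotient ?gFnorm // Lagrange ?center_sub.
rewrite oq => /eqP; rewrite eq_sym => /eqP def_p3.
have : (p ^ 3 < p * p * p ^ i.+2)%N.
  by rewrite -mulnA -!expnS ltn_exp2l.
by rewrite ltnNge def_p3 leq_mul2r oZA orbT.
Qed.

Section Generators.
Variable A : {group gT}.
Hypotheses (sAH : A \subset H) (abA : abelian A) (oA : #|A| = (p ^ 3)%N).

Let AH a : a \in A -> a \in H. Proof. exact: (subsetP sAH). Qed.
Let cA a b : a \in A -> b \in A -> commute a b.
Proof. by move=> Aa Ab; apply: (centsP abA). Qed.

Fact index_maxclass_abelian : #|H : A| = p.
Proof.
have := Lagrange sAH; rewrite oA oH (expnSr p 3) => /eqP.
by rewrite eqn_pmul2l ?expn_gt0 ?prime_gt0 // => /eqP.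
Qed.

Fact maxclass_abelian_normal : A <| H.
Proof.
apply: (p_maximal_normal pH); apply: p_index_maximal => //.
by rewrite index_maxclass_abelian.
Qed.

Let commA a h : a \in A -> h \in H -> [~ a, h] \in A.
Proof.
move=> Aa Hh; rewrite commgEl groupM ?groupV // memJ_norm //.
by apply: subsetP Hh; apply: normal_norm maxclass_abelian_normal.
Qed.

Let expA h : h \in H -> h ^+ p \in A.
Proof.
move=> Hh; have Nh : h \in 'N(A) by apply: subsetP Hh;
  apply: normal_norm maxclass_abelian_normal.
rewrite coset_idr ?groupX ?morphX //=; apply/eqP; rewrite -order_dvdn.
by rewrite -index_maxclass_abelian -card_quotient ?normal_norm ?maxclass_abelian_normal
  // order_dvdG ?mem_quotient.
Qed.

(** The kernel of D = [-, x] on A is Z: the centralizer of a contains A and x,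
    and A is maximal. *)
Lemma comm1_center x a : x \in H -> x \notin A -> a \in A -> commute a x ->
  a \in 'Z(H).
Proof.
move=> Hx nAx Aa cax; have sCH : 'C_H[a] \subset H := subsetIl _ _.
have sAC : A \proper 'C_H[a].
  apply/properP; split; last by exists x => //; apply/setIP; split=> //; apply/cent1P.
  apply/subsetP=> b Ab; apply/setIP; split; first exact: AH.
  by apply/cent1P; apply: cA.
have := leq_mul_card_proper p_pr (pgroupS sCH pH) sAC.
rewrite oA -expnS -oH => le_HC; have /eqP defC : 'C_H[a] == H by rewrite eqEcard sCH.
apply/centerP; split=> [|h]; first exact: AH.
by rewrite -{1}defC => /setIP[_ /cent1P].
Qed.

Section Pair.
Variables x y : gT.
Hypotheses (Hx : x \in H) (Ay : y \in A).
Let b := [~ y, x].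
Let c := [~ b, x].
Hypothesis nAx : x \notin A.

Let Ab : b \in A. Proof. exact: commA. Qed.
Let Ac : c \in A. Proof. exact: commA. Qed.

(** The nilpotency class is at most 3, so D kills c. *)
Fact maxclass_c_center : c \in 'Z(H).
Proof.
apply: comm1_center nAx _ _ => //; apply/commgP/eqP.
have nilc : nil_class H <= 3.
  by have := nil_class_pgroup pH; rewrite oH pfactorK.
have L4 : 'L_4(H) = 1 by apply/(lcn_nil_classP _ (pgroup_nil pH)).
suff : [~ c, x] \in 'L_4(H) by rewrite L4 => /set1P.
rewrite !lcnSn lcn1; apply: mem_commg => //.
by apply: mem_commg => //; apply: mem_commg => //; apply: AH.
Qed.
Let Zc := maxclass_c_center.

Let cp : c ^+ p = 1.
Proof. by apply/eqP; rewrite -order_dvdn -oZ order_dvdG. Qed.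

Let ccx : commute c x. Proof. exact: center_commute Zc Hx. Qed.
Let cbc : commute b c. Proof. exact: cA. Qed.

Let odd_p : odd p. Proof. by case: (even_prime p_pr) p_gt3 => [->|]. Qed.

(** As x^p lies in the abelian group A, it commutes with y; by
    [comm_expg_class3] the commutator is b^p c^'C(p, 2), where c^p = 1. *)
Fact maxclass_b_expp : b ^+ p = 1.
Proof.
have [+ _] := comm_expg_class3 p ccx cbc.
rewrite bin2odd // expgnA cp expg1n mulg1 => <-.
by apply/eqP/commgP/cA => //; apply: expA.
Qed.

Fact maxclass_x_expp : x ^+ p \in 'Z(H).
Proof.
apply: (comm1_center Hx nAx); first exact: expA.
exact/commute_sym/commuteX.
Qed.

Fact maxclass_y_expp : y ^+ p \in 'Z(H).
Proof.
apply: (comm1_center Hx nAx); first exact: groupX.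
apply/commgP/eqP; rewrite commXg ?maxclass_b_expp //.
exact: cA.
Qed.

(** This needs p to divide 'C(p, 3), that is p > 3. *)
Fact maxclass_expM : (x * y) ^+ p = x ^+ p * y ^+ p.
Proof.
rewrite (expMg_class3 p ccx (cA Ay Ab) (cA Ay Ac) cbc) -/b -/c.
have p3 : p %| 'C(p, 3) by rewrite prime_dvd_bin // p_gt3.
rewrite -(divnK p3) mulnC expgnA cp expg1n mulg1.
by rewrite bin2odd // expgnA maxclass_b_expp expg1n mulg1.
Qed.

Hypothesis nc : c != 1.

Fact maxclass_center : 'Z(H) = <[c]>.
Proof.
by apply/eqP; rewrite eq_sym eqEcard cycle_subG Zc oZ /= -orderE (order_eq_prime p_pr).
Qed.

(** The chain is 1 < Z < {a in A | D a in Z} < A < H. *)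
Fact maxclass_gen : <<[set x; y; b; c]>> = H.
Proof.
have gK : group_set [set a in A | [~ a, x] \in 'Z(H)].
  apply/group_setP; split=> [|u v]; first by apply/setIdP; rewrite group1 comm1g group1.
  move=> /setIdP[Au Zu] /setIdP[Av Zv]; apply/setIdP; split; first exact: groupM.
  by rewrite commMgJ groupM // conjgE (center_commute Zu (AH Av)) mulKg.
apply: (gen4_chain (M2 := A) (M3 := group gK) (M4 := 'Z(H)%G) p_pr oH) => //.
- apply/subsetP=> z Zz; apply/setIdP; rewrite (commg_center Zz) // group1; split=> //.
  by move: Zz; rewrite /= maxclass_center => /cycleP[i ->]; rewrite groupX.
- by apply/subsetP=> a /setIdP[].
- by apply/setDP.
- apply/setDP; split=> //; apply: contra nc => /setIdP[_ Zb].
  by rewrite /c (commg_center Zb).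
- apply/setDP; split; first exact/setIdP.
  by apply: contra nc => Zb; rewrite /c (commg_center Zb).
- by rewrite in_setD1 nc Zc.
Qed.

Lemma maxclass_satisfies k :
    match k with
    | 7 => x ^+ p = 1 /\ y ^+ p = 1
    | 8 => x ^+ p = c /\ y ^+ p = 1
    | 9 => x ^+ p = 1 /\ y ^+ p = c
    | 10 => x ^+ p = 1 /\ y ^+ p = c ^+ w
    | _ => False
    end -> satisfies p w k H.
Proof.
move=> xyp; exists (quadruple x y b c); split; first exact: maxclass_gen.
have comm1 u v : u \in A -> v \in A -> [~ u, v] = 1.
  by move=> Au Av; apply/eqP/commgP/cA.
by move: xyp; do 11?[case: k => [|k] //]; case=> xp yp; apply/pc_relationsP;
  rewrite /rhs /quadruple /= xp yp maxclass_b_expp cp -/b -/c (commg_center Zc Hx) !comm1.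
Qed.

End Pair.

End Generators.

(** Take x outside A and y in A with D^2 y <> 1. If y^p = 1, the group is the
    seventh or the eighth; otherwise y^p generates Z, x can be corrected to
    x^p = 1, and the exponent n in y^p = (D^2 y)^n is normalised modulo squares
    by the hypothesis. *)
Lemma maxclass_exists :
    (forall n, ~~ (p %| n) ->
       exists r, n = r ^ 2 %[mod p] \/ n = r ^ 2 * w %[mod p]) ->
  exists2 k, 1 <= k <= 15 & satisfies p w k H.
Proof.
move=> sqr; have [A [sAH abA oA]] := maxclass_abelian_subgroup.
have cA a b : a \in A -> b \in A -> commute a b.
  by move=> Aa Ab; apply: (centsP abA).
have AH a : a \in A -> a \in H by apply: (subsetP sAH).
have nHA h a : h \in H -> a \in A -> [~ a, h] \in A.
  move=> Hh Aa; rewrite commgEl groupM ?groupV // memJ_norm //.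
  by apply: subsetP Hh; apply: normal_norm (maxclass_abelian_normal sAH oA).
have [x Hx nAx] : exists2 x, x \in H & x \notin A.
  apply/subsetPn/negP=> /subset_leq_card; apply/negP.
  by rewrite -ltnNge oA oH ltn_exp2l ?prime_gt1.
have [y Ay nc] : exists2 y, y \in A & [~ [~ y, x], x] != 1.
  have [/exists_inP //|] := boolP [exists y in A, [~ [~ y, x], x] != 1].
  move=> all1; have Zb a : a \in A -> [~ a, x] \in 'Z(H).
    move=> Aa; apply: (comm1_center sAH abA oA Hx nAx); first exact: nHA.
    by apply/commgP; apply: contraNT all1 => na; apply/exists_inP; exists a.
  (* If D^2 = 1, both the kernel and the image of D would lie in Z, of order p. *)
  have leC : #|'C_A[x]| <= p.
    rewrite -oZ subset_leq_card //; apply/subsetP=> a /setIP[Aa /cent1P cxa].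
    exact: (comm1_center sAH abA oA Hx nAx).
  have leJ : #|x ^: A| <= p.
    rewrite -oZ -(card_lcoset 'Z(H) x) subset_leq_card //.
    apply/subsetP=> _ /imsetP[a Aa ->]; apply/lcosetP; exists [~ x, a].
      by rewrite -invg_comm groupV Zb.
    by rewrite commgEl mulKVg.
  have := leq_mul leC leJ; rewrite -index_cent1 Lagrange ?subsetIl // oA.
  by rewrite leqNgt mulnn (ltn_exp2l 2) ?prime_gt1.
pose b := [~ y, x]; pose c := [~ b, x].
have Hy := AH _ Ay; have Ab : b \in A by apply: nHA.
have [yp1 | nyp] := eqVneq (y ^+ p) 1.
  have [xp1 | nxp] := eqVneq (x ^+ p) 1.
    by exists 7 => //; apply: (maxclass_satisfies sAH abA oA Hx Ay nAx nc).
  have := maxclass_x_expp sAH abA oA Hx nAx.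
  rewrite (maxclass_center sAH abA oA Hx Ay nAx nc) => /cycleP[i xp].
  have comm_yi : [~ [~ y ^+ i, x], x] = x ^+ p.
    by rewrite !commXg //; apply: cA; rewrite ?nHA.
  exists 8 => //; apply: (maxclass_satisfies sAH abA oA Hx (y := y ^+ i)) => //.
  - exact: groupX.
  - by rewrite comm_yi.
  - by rewrite comm_yi expgnAC yp1 expg1n.
have Zy := maxclass_y_expp sAH abA oA Hx Ay nAx.
(* Multiplying x by a power of y leaves the commutators unchanged and makes its
   p-th power trivial. *)
have [x1 [Hx1 nc1 x1p]] : exists x1, [/\ x1 \in H, [~ [~ y, x1], x1] != 1 & x1 ^+ p = 1].
  have : x ^+ p \in <[y ^+ p]>.
    have -> : <[y ^+ p]> = 'Z(H).
      apply/eqP; rewrite eqEcard cycle_subG Zy oZ -orderE.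
      by rewrite /= (order_eq_prime p_pr) // (center_exp Zy).
    exact: maxclass_x_expp nAx.
  case/cycleP=> i xp; have Au : y ^- i \in A by rewrite groupV groupX.
  have commu a : a \in A -> [~ a, x * y ^- i] = [~ a, x].
    move=> Aa; have cu : [~ a, y ^- i] = 1 by apply/eqP/commgP/cA.
    have Aax := nHA _ _ Hx Aa.
    by rewrite commgMJ cu mul1g conjgE (cA _ _ Aax Au) mulKg.
  exists (x * y ^- i); rewrite !commu ?nHA // groupM ?(AH _ Au) //; split=> //.
  by rewrite (maxclass_expM sAH abA oA Hx Au nAx) xp expgVn expgnAC mulgV.
have nAx1 : x1 \notin A by apply: contra nc1 => Ax1; apply/commgP/cA; rewrite ?nHA.
have Ab1 : [~ y, x1] \in A by apply: nHA.
set c1 := [~ [~ y, x1], x1] in nc1; have Ac1 : c1 \in A by apply: nHA.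
have Zc1 : c1 \in 'Z(H) := maxclass_c_center sAH abA oA Hx1 Ay nAx1.
have oc1 : #[c1] = p by rewrite (order_eq_prime p_pr) ?center_exp.
have := Zy; rewrite (maxclass_center sAH abA oA Hx1 Ay nAx1 nc1).
case/cycleP=> n yp; have [|r rE] := sqr n.
  by rewrite -oc1 order_dvdn -yp.
(* Replacing x1 by z = x1^r raises the end of the chain to the power r^2. *)
pose z := x1 ^+ r; have Hz : z \in H by rewrite groupX.
have cz : [~ [~ y, z], z] = c1 ^+ (r ^ 2).
  have [-> cb] := comm_expg_class3 r (center_commute Zc1 Hx1) (cA _ _ Ab1 Ac1).
  rewrite commMgJ commXg; last first.
    by apply: cA; rewrite ?nHA.
  rewrite cb (commXg _ (cA _ _ _ _)) ?nHA ?groupX //.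
  rewrite (commg_center Zc1 Hz) expg1n mulg1 conjgE (cA (c1 ^+ r ^+ r)) ?groupX //.
  by rewrite mulKg -expgnA mulnn.
have zp1 : z ^+ p = 1 by rewrite /z expgnAC x1p expg1n.
have ypE m : n = m %[mod p] -> y ^+ p = c1 ^+ m.
  by move=> nm; rewrite yp; apply/eqP; rewrite eq_expg_mod_order oc1 nm.
have ncz : [~ [~ y, z], z] != 1.
  rewrite cz; apply: contra nyp => /eqP c1r.
  by case: rE => /ypE->; rewrite ?(expgnA c1 (r ^ 2) w) c1r ?expg1n.
have nAz : z \notin A by apply: contra ncz => Az; apply/commgP/cA; rewrite ?nHA.
case: rE => /ypE ypr; [exists 9 | exists 10] => //;
  apply: (maxclass_satisfies sAH abA oA Hz Ay nAz ncz); split=> //; rewrite cz ypr //.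
by rewrite (expgnA c1 (r ^ 2) w).
Qed.

End MaxClass.

(** * Abelian groups of order p^4 *)

Section Abelian.
Variables (gT : finGroupType) (p w : nat) (H : {group gT}).
Hypotheses (p_pr : prime p) (oH : #|H| = (p ^ 4)%N) (abH : abelian H).
Implicit Types x y z : gT.

Let cH x y : x \in H -> y \in H -> [~ x, y] = 1.
Proof. by move=> Hx Hy; apply/eqP/commgP; apply: (centsP abH). Qed.

Lemma abelian_satisfies k x1 x2 x3 x4 : <<[set x1; x2; x3; x4]>> = H ->
    match k with
    | 1 => [/\ x1 ^+ p = x2, x2 ^+ p = x3, x3 ^+ p = x4 & x4 ^+ p = 1]
    | 2 => [/\ x1 ^+ p = x3, x2 ^+ p = x4, x3 ^+ p = 1 & x4 ^+ p = 1]
    | 5 => [/\ x1 ^+ p = x3, x2 ^+ p = 1, x3 ^+ p = x4 & x4 ^+ p = 1]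
    | 11 => [/\ x1 ^+ p = x4, x2 ^+ p = 1, x3 ^+ p = 1 & x4 ^+ p = 1]
    | _ => False
    end -> satisfies p w k H.
Proof.
move=> defH Rk; exists (quadruple x1 x2 x3 x4); split=> //.
have Hx x : x \in [set x1; x2; x3; x4] -> x \in H by rewrite -defH; apply: mem_gen.
have H1 : x1 \in H by rewrite Hx // !inE eqxx.
have H2 : x2 \in H by rewrite Hx // !inE eqxx orbT.
have H3 : x3 \in H by rewrite Hx // !inE eqxx !orbT.
have H4 : x4 \in H by rewrite Hx // !inE eqxx !orbT.
by move: Rk; do 12?[case: k => [|k] //]; case=> R1 R2 R3 R4; apply/pc_relationsP;
  rewrite /rhs /quadruple /= !cH.
Qed.

Fact bigdprod_cycle_mem (b : seq gT) (G : {group gT}) :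
  \big[dprod/1]_(x <- b) <[x]> = G -> {subset b <= G}.
Proof.
elim: b G => // x b IHb G; rewrite big_cons => /dprodP[[_ K _ defK]].
rewrite defK => <- _ _ y; rewrite inE => /predU1P[-> | by_].
  by rewrite (subsetP (mulG_subl _ _)) ?cycle_id.
by rewrite (subsetP (mulG_subr _ _)) ?(IHb K).
Qed.

(** The decreasing type of H is one of the five partitions of 4. *)
Lemma abelian_exists :
  (exists2 k, 1 <= k <= 15 & satisfies p w k H) \/ p.-abelem H.
Proof.
have [b defH ob] := abelian_structure abH.
have p_gt0 := prime_gt0 p_pr; have p_gt1 := prime_gt1 p_pr.
have prod_b := bigdprodW defH; have card_b := bigdprod_card defH.
have Hb := bigdprod_cycle_mem defH.
have genb (S : {set gT}) : {subset b <= S} -> S \subset H -> <<S>> = H.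
  move=> bS sSH; apply/eqP; rewrite eqEsubset gen_subG sSH /= -prod_b.
  have: {subset b <= <<S>>} by move=> x /bS; apply: mem_gen.
  elim: {prod_b card_b Hb ob defH bS} b => [|x b IHb] Sb; first by rewrite big_nil sub1G.
  rewrite big_cons mul_subG ?cycle_subG ?Sb ?mem_head // IHb // => y by_.
  by rewrite Sb // inE by_ orbT.
have expb x : x \in b -> exists2 e, 0 < e & #[x] = (p ^ e)%N.
  move=> bx; have: #[x] %| p ^ 4 by rewrite -oH order_dvdG ?Hb.
  case/(dvdn_pfactor _ _ p_pr)=> e _ ox; exists e => //; rewrite lt0n.
  have : #[x] > 1 by apply: (allP (abelian_type_gt1 H)); rewrite -ob map_f.
  by apply: contraTneq => e0; rewrite ox e0.
have sorted_b := abelian_type_sorted H; rewrite -ob in sorted_b.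
rewrite oH in card_b.
have expnIp := expnI p_gt1.
have powe x e : #[x] = (p ^ e)%N -> x ^+ (p ^ e) = 1 by move=> <-; apply: expg_order.
have sub4 x1 x2 x3 x4 : x1 \in H -> x2 \in H -> x3 \in H -> x4 \in H ->
    [set x1; x2; x3; x4] \subset H.
  by move=> H1 H2 H3 H4; rewrite !subUset !sub1set H1 H2 H3 H4.
move: b card_b Hb genb expb sorted_b {ob defH prod_b} =>
  [|x [|y [|z [|t [|u b]]]]] card_b Hb genb expb sorted_b.
- by move: card_b; rewrite big_nil => /esym/eqP; rewrite -(expn0 p) eqn_exp2l.
- have [e _ ox] := expb x (mem_head _ _); have Hx := Hb x (mem_head _ _).
  move: card_b; rewrite big_seq1 -orderE ox => /expnIp e4; rewrite {e}e4 in ox.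
  left; exists 1%N => //.
  apply: (@abelian_satisfies 1 x (x ^+ p) (x ^+ p ^+ p) (x ^+ p ^+ p ^+ p)).
    by apply: genb; [move=> v; rewrite !inE => ->|apply: sub4; rewrite ?groupX].
  by split=> //; rewrite -!expgnA; apply: (powe x 4).
- have bx : x \in [:: x; y] by rewrite inE eqxx.
  have by_ : y \in [:: x; y] by rewrite !inE eqxx orbT.
  have [e e0 ox] := expb x bx; have [f f0 oy] := expb y by_.
  have Hx := Hb x bx; have Hy := Hb y by_.
  move: card_b sorted_b; rewrite big_cons big_seq1 -!orderE /= ox oy -expnD.
  rewrite andbT leq_exp2l // => /expnIp ef4 le_fe.
  have [[e3 f1]|[e2 f2]] : e = 3 /\ f = 1%N \/ e = 2 /\ f = 2.
    by lia.
  + left; exists 5 => //; rewrite e3 in ox; rewrite f1 in oy.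
    apply: (@abelian_satisfies 5 x y (x ^+ p) (x ^+ p ^+ p)).
      apply: genb; last by apply: sub4; rewrite ?groupX.
      by move=> v; rewrite !inE => /orP[]->; rewrite ?orbT.
    by split; rewrite // -?expgnA; [apply: (powe y 1%N) | apply: (powe x 3)].
  + left; exists 2 => //; rewrite e2 in ox; rewrite f2 in oy.
    apply: (@abelian_satisfies 2 x y (x ^+ p) (y ^+ p)).
      apply: genb; last by apply: sub4; rewrite ?groupX.
      by move=> v; rewrite !inE => /orP[]->; rewrite ?orbT.
    by split; rewrite // -?expgnA; [apply: (powe x 2) | apply: (powe y 2)].
- have bx : x \in [:: x; y; z] by rewrite !inE eqxx.
  have by_ : y \in [:: x; y; z] by rewrite !inE eqxx orbT.
  have bz : z \in [:: x; y; z] by rewrite !inE eqxx !orbT.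
  have [e e0 ox] := expb x bx; have [f f0 oy] := expb y by_.
  have [g g0 oz] := expb z bz.
  have Hx := Hb x bx; have Hy := Hb y by_; have Hz := Hb z bz.
  move: card_b sorted_b; rewrite !big_cons big_nil muln1 -!orderE /= ox oy oz -!expnD.
  rewrite andbT !leq_exp2l // => /expnIp efg4 /andP[le_fe le_gf].
  have [e2 [f1 g1]] : e = 2 /\ f = 1%N /\ g = 1%N.
    by lia.
  left; exists 11 => //; rewrite e2 in ox; rewrite f1 in oy; rewrite g1 in oz.
  apply: (@abelian_satisfies 11 x y z (x ^+ p)).
    apply: genb; last by apply: sub4; rewrite ?groupX.
    by move=> v; rewrite !inE => /or3P[]->; rewrite ?orbT.
  by split; rewrite // -?expgnA;
    [apply: (powe y 1%N) | apply: (powe z 1%N) | apply: (powe x 2)].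
- right; apply/(abelemP p_pr); split=> // v Hv.
  have gb : <<[set v in [:: x; y; z; t]]>> = H.
    apply: genb => [v'|]; first by rewrite !inE.
    by apply/subsetP=> v'; rewrite inE; apply: Hb.
  have expM : {in H &, {morph (fun v => v ^+ p) : v1 v2 / v1 * v2}}.
    by move=> v1 v2 H1 H2; apply: expgMn; apply: (centsP abH).
  apply/set1P; apply: (expg_gen_sub (N := 1%G) gb expM) Hv => v1; rewrite inE => bv1.
  have [e e0 ov1] := expb v1 bv1; apply/set1P.
  suff e1 : e = 1%N by apply: (powe v1 1%N); rewrite ov1 e1.
  have bx : x \in [:: x; y; z; t] by rewrite !inE eqxx.
  have by_ : y \in [:: x; y; z; t] by rewrite !inE eqxx orbT.
  have bz : z \in [:: x; y; z; t] by rewrite !inE eqxx !orbT.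
  have bt : t \in [:: x; y; z; t] by rewrite !inE eqxx !orbT.
  have [f f0 ox] := expb x bx; have [g g0 oy] := expb y by_.
  have [h h0 oz] := expb z bz; have [i i0 ot] := expb t bt.
  move: card_b; rewrite !big_cons big_nil muln1 -!orderE ox oy oz ot -!expnD.
  move/expnIp=> fghi4.
  have [f1 [g1 [h1 i1]]] : f = 1%N /\ g = 1%N /\ h = 1%N /\ i = 1%N.
    by lia.
  apply: expnIp; rewrite -ov1.
  by move: bv1; rewrite !inE => /or4P[] /eqP->; rewrite ?ox ?oy ?oz ?ot ?f1 ?g1 ?h1 ?i1.
exfalso.
have big v : v \in [:: x, y, z, t, u & b] -> p <= #[v].
  by case/expb=> e e0 ->; rewrite -{1}(expn1 p) leq_exp2l.
have : p ^ 5 <= p ^ 4.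
  rewrite -card_b !big_cons -!orderE !expnS expn0.
  do 5![apply: leq_mul; first by apply: big; rewrite !inE eqxx ?orbT].
  by rewrite big_seq; apply: prodn_cond_gt0 => v _; apply: cardG_gt0.
by rewrite leq_exp2l.
Qed.

End Abelian.

(** * Squares modulo p *)

Section Squares.
Variables (p : nat) (w : {unit 'F_p}).
Hypotheses (p_pr : prime p) (w_gen : generator [set: {unit 'F_p}] w).
Let wn : nat := val (val w).

Fact eq_Fp_nat m n : (m%:R == n%:R :> 'F_p)%R = (m == n %[mod p]).
Proof. by rewrite -val_eqE /= !val_Fp_nat. Qed.

Fact natr_val_unit (u : {unit 'F_p}) : ((val (val u))%:R = val u :> 'F_p)%R.
Proof. exact: natr_Zp. Qed.

Lemma unit_nat_power n : ~~ (p %| n) -> exists m, (n%:R = (val w) ^+ m :> 'F_p)%R.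
Proof.
move=> ndvd; have Un : (n%:R : 'F_p)%R \is a GRing.unit.
  rewrite GRing.unitfE -(GRing.mulr0n 1%R) eq_Fp_nat mod0n.
  by move: ndvd; rewrite /dvdn.
have : FinRing.unit 'F_p Un \in <[w]> by rewrite -(eqP w_gen) inE.
by case/cycleP=> m /(congr1 val) /= ->; exists m; rewrite FinRing.val_unitX.
Qed.

(** n is a power of w; split off the parity of the exponent. *)
Lemma square_class n : ~~ (p %| n) ->
  exists r, n = r ^ 2 %[mod p] \/ n = r ^ 2 * wn %[mod p].
Proof.
case/unit_nat_power=> m nE; pose v := w ^+ m./2; exists (val (val v)).
have rE : ((val (val v))%:R = (val w) ^+ m./2 :> 'F_p)%R.
  by rewrite natr_val_unit /v FinRing.val_unitX.
case: (boolP (odd m)) => mo; [right | left]; apply/eqP; rewrite -eq_Fp_nat nE.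
  rewrite GRing.natrM GRing.natrX rE -GRing.exprM muln2.
  by rewrite natr_val_unit -GRing.exprSr -{1}(odd_double_half m) mo.
rewrite GRing.natrX rE -GRing.exprM muln2.
by rewrite -{1}(odd_double_half m) (negPf mo).
Qed.

(** The order p - 1 of w is even, so w is not an even power of itself. *)
Lemma generator_nonsquare r : 2 < p -> r ^ 2 <> wn %[mod p].
Proof.
move=> p_gt2 r2.
have rE : ((r ^ 2)%:R = val w :> 'F_p)%R.
  by rewrite -(natr_val_unit w); apply/eqP; rewrite eq_Fp_nat; apply/eqP.
have [|m mE] := @unit_nat_power r.
  apply/negP=> /dvdnP[q rq]; have := valP w; rewrite -rE rq expnMn -mulnn mulnA.
  by rewrite GRing.natrM (eqP (_ : p%:R == 0 :> 'F_p)%R) ?GRing.mulr0 ?GRing.unitr0 //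
    -(GRing.mulr0n 1%R) eq_Fp_nat modnn mod0n.
have /eqP : w ^+ (m * 2) = w ^+ 1.
  by apply: val_inj; rewrite FinRing.val_unitX GRing.exprM -mE -GRing.natrX rE.
rewrite eq_expg_mod_order => /eqP eq_m.
have even_w : ~~ odd #[w].
  rewrite orderE -(eqP w_gen) card_finField_unit card_Fp // -subn1 oddB ?prime_gt0 //.
  by case: (even_prime p_pr) p_gt2 => [->|->].
have := congr1 odd (divn_eq (m * 2) #[w]); have := congr1 odd (divn_eq 1 #[w]).
by rewrite !oddD !oddM eq_m (negPf even_w) !andbF /= => <-.
Qed.
End Squares.

(** * A group law with carries *)

(** Data for a group with elements x1^a x2^x m, with a, x < p and m in A, where
    x1^p = z1, x2^p = z2, [x2, x1] = c, [m, x1] = D m and x2 centralizes A.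
    A is a ring so that [ring] applies to its elements. *)
Record carry_data := CarryData {
  cd_p : nat;
  cd_A : finComNzRingType;
  cd_D : cd_A -> cd_A;
  cd_c : cd_A; cd_z1 : cd_A; cd_z2 : cd_A;
  cd_p_gt0 : 0 < cd_p;
  cd_p_odd : odd cd_p;
  cd_DD : forall m n, (cd_D (m + n) = cd_D m + cd_D n)%R;
  cd_D2 : forall m, (cd_D (cd_D m) = 0)%R;
  cd_Dp : forall m, (cd_D m *+ cd_p = 0)%R;
  cd_cp : (cd_c *+ cd_p = 0)%R;
  cd_Dz1 : cd_D cd_z1 = 0%R;
  cd_Dz2 : cd_D cd_z2 = 0%R
}.

Definition carry_group (d : carry_data) : Type :=
  ('I_(cd_p d) * 'I_(cd_p d) * cd_A d)%type.
HB.instance Definition _ d := Finite.on (carry_group d).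

Section CarryGroup.
Variable d : carry_data.
Local Notation p := (cd_p d).
Local Notation A := (cd_A d).
Local Notation D := (@cd_D d).
Local Notation c := (cd_c d).
Local Notation z1 := (cd_z1 d).
Local Notation z2 := (cd_z2 d).
Local Notation triple := (nat * nat * A)%type.
Local Open Scope ring_scope.
Import GRing.Theory.

(** The law before reduction of the exponents: moving x1^b to the left past
    x2^x m turns x2 into x2 c^b (D c)^'C(b, 2), and m into m (D m)^b. *)
Definition triple_mul (u v : triple) : triple :=
  let: (a, x, m) := u in let: (b, y, n) := v in
  ((a + b)%N, (x + y)%N,
   m + D m *+ b + n + c *+ (b * x) + D c *+ ('C(b, 2) * x)).

Definition reduce (u : triple) : carry_group d :=
  let: (a, x, m) := u in
  (Ordinal (ltn_pmod a (cd_p_gt0 d)), Ordinal (ltn_pmod x (cd_p_gt0 d)),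
   m + z1 *+ (a %/ p) + z2 *+ (x %/ p)).

Definition triple_of (u : carry_group d) : triple :=
  let: (a, x, m) := u in (val a, val x, m).

Fact carry_D0 : D 0 = 0.
Proof. by apply: (addrI (D 0)); rewrite -cd_DD ?(addr0). Qed.

Fact carry_DMn m k : D (m *+ k) = D m *+ k.
Proof. by elim: k => [|k IHk]; rewrite ?carry_D0 // !mulrS cd_DD IHk. Qed.

Fact bin2D m n : 'C(m + n, 2) = ('C(m, 2) + 'C(n, 2) + m * n)%N.
Proof.
by elim: n => [|n IHn]; rewrite ?(addn0) ?(muln0) ?(addn0) // addnS !binS !bin1 IHn; lia.
Qed.

Fact dvdn_bin2 k : (p %| 'C(k * p, 2))%N.
Proof.
elim: k => [|k IHk]; first by rewrite bin0n.
by rewrite mulSn bin2D !dvdn_add ?IHk // ?dvdn_mulr // bin2odd ?cd_p_odd ?dvdn_mulr.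
Qed.

(** This is where p has to be odd. *)
Fact bin2_mod b : 'C(b %% p, 2) = 'C(b, 2) %[mod p].
Proof.
apply/esym; rewrite {1}(divn_eq b p) bin2D -addnA -modnDml (eqP (dvdn_bin2 _)).
by rewrite add0n mulnAC -modnDmr modnMl addn0.
Qed.

Fact mulrn_mod (m : A) k l : m *+ p = 0 -> k = l %[mod p] -> m *+ k = m *+ l.
Proof.
have mod_p n : m *+ p = 0 -> m *+ n = m *+ (n %% p).
  by move=> mp; rewrite {1}(divn_eq n p) mulrnDr mulnC mulrnA mp mul0rn add0r.
by move=> mp kl; rewrite mod_p // kl -mod_p.
Qed.

Fact triple_mulA : associative triple_mul.
Proof.
move=> [[a x] m] [[b y] n] [[e z] o] /=; congr (_, _, _); rewrite ?addnA //.
rewrite !cd_DD !carry_DMn !cd_D2 ?(mul0rn) bin2D; ring.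
Qed.

Fact reduce_add a x m k l :
  reduce ((a + k * p)%N, (x + l * p)%N, m) = reduce (a, x, m + z1 *+ k + z2 *+ l).
Proof.
have p_gt0 := cd_p_gt0 d.
rewrite /reduce; congr (_, _, _); try by apply: val_inj; rewrite /= addnC modnMDl.
by rewrite ![(_ + _ * p)%N]addnC !divnMDl //; ring.
Qed.

Fact reduce_carry1 x m : reduce (p, x, m) = reduce (0%N, x, m + z1).
Proof.
by have := reduce_add 0 x m 1 0; rewrite mul1n mul0n addn0 add0n mulr0n addr0.
Qed.

Fact reduce_carry2 a m : reduce (a, p, m) = reduce (a, 0%N, m + z2).
Proof.
by have := reduce_add a 0 m 0 1; rewrite mul1n mul0n addn0 add0n mulr0n addr0.
Qed.

Fact triple_of_reduce a x m : triple_of (reduce (a, x, m)) =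
  ((a %% p)%N, (x %% p)%N, m + z1 *+ (a %/ p) + z2 *+ (x %/ p)).
Proof. by []. Qed.

(** Reduction of the exponents is a congruence for [triple_mul], so
    associativity passes to reduced triples. *)
Fact reduceMl u v : reduce (triple_mul (triple_of (reduce u)) v) = reduce (triple_mul u v).
Proof.
case: u => [[a x] m]; case: v => [[b y] n]; rewrite triple_of_reduce /triple_mul.
have E1 : c *+ (b * (x %% p)) = c *+ (b * x).
  by apply: mulrn_mod (cd_cp d) _; rewrite modnMmr.
have E2 : D c *+ ('C(b, 2) * (x %% p)) = D c *+ ('C(b, 2) * x).
  by apply: mulrn_mod (cd_Dp c) _; rewrite modnMmr.
rewrite E1 E2 !cd_DD !carry_DMn cd_Dz1 cd_Dz2 ?(mul0rn) ?(addr0).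
have -> : (a + b = a %% p + b + a %/ p * p)%N by rewrite {1}(divn_eq a p); lia.
have -> : (x + y = x %% p + y + x %/ p * p)%N by rewrite {1}(divn_eq x p); lia.
rewrite reduce_add; congr (reduce (_, _, _)); ring.
Qed.

Fact reduceMr u v : reduce (triple_mul u (triple_of (reduce v))) = reduce (triple_mul u v).
Proof.
case: u => [[a x] m]; case: v => [[b y] n]; rewrite triple_of_reduce /triple_mul.
have E0 : D m *+ (b %% p) = D m *+ b.
  by apply: mulrn_mod (cd_Dp m) _; rewrite modn_mod.
have E1 : c *+ (b %% p * x) = c *+ (b * x).
  by apply: mulrn_mod (cd_cp d) _; rewrite modnMml.
have E2 : D c *+ ('C(b %% p, 2) * x) = D c *+ ('C(b, 2) * x).
  by apply: mulrn_mod (cd_Dp c) _; rewrite -modnMml bin2_mod modnMml.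
rewrite E0 E1 E2.
have -> : (a + b = a + b %% p + b %/ p * p)%N by rewrite {1}(divn_eq b p); lia.
have -> : (x + y = x + y %% p + y %/ p * p)%N by rewrite {1}(divn_eq y p); lia.
rewrite reduce_add; congr (reduce (_, _, _)); ring.
Qed.

Fact triple_ofK u : reduce (triple_of u) = u.
Proof.
case: u => [[a x] m] /=; rewrite !divn_small // ?(addr0).
by congr (_, _, _); apply: val_inj; rewrite /= modn_small.
Qed.

Definition carry_mul (u v : carry_group d) := reduce (triple_mul (triple_of u) (triple_of
  v)).
Definition carry_one : carry_group d := reduce (0%N, 0%N, 0).
(** m^-1 x2^(p-x) z2^-1 x1^(p-a) z1^-1, the inverse of x1^a x2^x m. *)
Definition carry_inv (u : carry_group d) : carry_group d :=
  let: (a, x, m) := triple_of u in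
  carry_mul (reduce (0%N, 0%N, - m))
    (carry_mul (reduce (0%N, (p - x)%N, - z2)) (reduce ((p - a)%N, 0%N, - z1))).

Fact reduceM u v : carry_mul (reduce u) (reduce v) = reduce (triple_mul u v).
Proof. by rewrite /carry_mul reduceMl reduceMr. Qed.

Fact carry_mulA : associative carry_mul.
Proof.
by move=> u v w;
  rewrite -(triple_ofK u) -(triple_ofK v) -(triple_ofK w) !reduceM triple_mulA.
Qed.

Fact carry_mul1 : left_id carry_one carry_mul.
Proof.
move=> u; rewrite -(triple_ofK u) reduceM; case: (triple_of u) => [[a x] m].
by rewrite /triple_mul carry_D0 ?(muln0) ?(mulr0n) mul0rn ?(add0r) ?(addr0) ?(add0n).
Qed.

Fact carry_mulV : left_inverse carry_one carry_inv carry_mul.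
Proof.
have DN z : D z = 0 -> D (- z) = 0.
  by move=> Dz; apply: (addrI (D z)); rewrite -cd_DD subrr carry_D0 Dz addr0.
have p_gt0 := cd_p_gt0 d.
move=> u; rewrite -{2}(triple_ofK u) /carry_inv.
have: ((triple_of u).1.1 <= p /\ (triple_of u).1.2 <= p)%N.
  by case: u => [[a x] m]; split; apply/ltnW/ltn_ord.
case: (triple_of u) => [[a x] m] [ap xp]; simpl in ap; simpl in xp.
have S1 : carry_mul (reduce ((p - a)%N, 0%N, - z1)) (reduce (a, x, m)) =
    reduce (0%N, x, m).
  rewrite reduceM /triple_mul (DN _ (cd_Dz1 d)) mul0rn ?(muln0) ?(mulr0n) ?(addr0).
  by rewrite subnK // add0n reduce_carry1 addrC addrA addrN add0r.
have S2 : carry_mul (reduce (0%N, (p - x)%N, - z2)) (reduce (0%N, x, m)) =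
    reduce (0%N, 0%N, m).
  rewrite reduceM /triple_mul (DN _ (cd_Dz2 d)) mul0rn ?bin0n ?(mul0n) ?(mulr0n) ?(addr0).
  by rewrite subnK // reduce_carry2 addrC addrA addrN add0r.
rewrite -!carry_mulA S1 S2 reduceM /triple_mul.
by rewrite ?(mulr0n) ?bin0n ?(mul0n) ?(mulr0n) ?(addr0) addNr.
Qed.

HB.instance Definition _ :=
  Finite_isGroup.Build (carry_group d) carry_mulA carry_mul1 carry_mulV.

Local Arguments reduce : simpl never.

Lemma reduce_mulg u v : (reduce u * reduce v)%g = reduce (triple_mul u v) :> carry_group d.
Proof. exact: reduceM. Qed.

Definition carry_x1 : carry_group d := reduce (1%N, 0%N, 0).
Definition carry_x2 : carry_group d := reduce (0%N, 1%N, 0).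
Definition carry_emb (m : A) : carry_group d := reduce (0%N, 0%N, m).

Fact carry_x1X n : (carry_x1 ^+ n)%g = reduce (n, 0%N, 0).
Proof.
elim: n => // n IHn; rewrite expgSr IHn reduce_mulg /triple_mul carry_D0.
by rewrite ?(muln0) ?(mulr0n) ?addn1 ?addr0 ?mul0rn ?addr0.
Qed.

Fact carry_x2X n : (carry_x2 ^+ n)%g = reduce (0%N, n, 0).
Proof.
elim: n => // n IHn; rewrite expgSr IHn reduce_mulg /triple_mul carry_D0.
by rewrite ?bin0n ?(mul0n) ?(mulr0n) ?(addr0) addn1.
Qed.

Fact carry_embM m n : (carry_emb m * carry_emb n)%g = carry_emb (m + n).
Proof.
by rewrite reduce_mulg /triple_mul ?bin0n ?(mul0n) ?(mulr0n) ?(addr0).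
Qed.

Fact carry_embX m n : (carry_emb m ^+ n)%g = carry_emb (m *+ n).
Proof.
by elim: n => // n IHn; rewrite expgSr IHn carry_embM mulrSr.
Qed.

Fact carry_normal_form u :
  u = (carry_x1 ^+ (triple_of u).1.1 * carry_x2 ^+ (triple_of u).1.2 * carry_emb
    (triple_of u).2)%g.
Proof.
rewrite carry_x1X carry_x2X -{1}(triple_ofK u); case: (triple_of u) => [[a x] m] /=.
rewrite (reduce_mulg (a, 0%N, 0) (0%N, x, 0)) reduce_mulg /triple_mul carry_D0.
by rewrite ?bin0n ?(mul0n) ?(mulr0n) ?(addr0) ?(addn0) add0n ?(add0r).
Qed.

Lemma carry_x1_expp : (carry_x1 ^+ p)%g = carry_emb z1.
Proof.
by rewrite carry_x1X reduce_carry1 add0r.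
Qed.

Lemma carry_x2_expp : (carry_x2 ^+ p)%g = carry_emb z2.
Proof.
by rewrite carry_x2X reduce_carry2 add0r.
Qed.

Lemma carry_comm21 : [~ carry_x2, carry_x1]%g = carry_emb c.
Proof.
apply: (mulgI (carry_x1 * carry_x2)%g); rewrite -commgC.
rewrite (reduce_mulg (1%N, 0%N, 0) (0%N, 1%N, 0)) !reduce_mulg /triple_mul.
by rewrite carry_D0 ?mul0rn ?bin0n ?bin1 ?muln0 ?mul0n ?muln1 ?mulr0n ?addr0 ?add0r.
Qed.

Lemma carry_comm_emb1 m : [~ carry_emb m, carry_x1]%g = carry_emb (D m).
Proof.
apply: (mulgI (carry_x1 * carry_emb m)%g); rewrite -commgC.
rewrite (reduce_mulg (1%N, 0%N, 0) (0%N, 0%N, m)) !reduce_mulg /triple_mul.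
by rewrite carry_D0 ?mul0rn ?bin0n ?muln0 ?mul0n ?mulr0n ?mulr1n ?addr0 ?add0r.
Qed.

Lemma carry_comm_emb2 m : [~ carry_emb m, carry_x2]%g = 1%g.
Proof.
apply/eqP/commgP; rewrite /commute !reduce_mulg /triple_mul.
by rewrite carry_D0 ?(mul0rn) ?bin0n ?(muln0) ?(mul0n) ?(mulr0n) ?(addr0) ?(add0r).
Qed.

Lemma carry_comm_emb m n : [~ carry_emb m, carry_emb n]%g = 1%g.
Proof. by apply/eqP/commgP; rewrite /commute !carry_embM addrC. Qed.

Lemma card_carry_group : #|[set: carry_group d]| = (p * p * #|A|)%N.
Proof. by rewrite cardsT !card_prod !card_ord. Qed.

Lemma carry_gen (m3 m4 : A) :
  (forall m, exists i j, m = m3 *+ i + m4 *+ j) ->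
  <<[set carry_x1; carry_x2; carry_emb m3; carry_emb m4]>>%g = [set: carry_group d].
Proof.
move=> gen34; apply/eqP; rewrite -subTset; apply/subsetP=> u _.
rewrite (carry_normal_form u); have [i [j ->]] := gen34 (triple_of u).2.
rewrite -carry_embM -!carry_embX.
by rewrite !groupM ?groupX // mem_gen // !inE eqxx ?orbT.
Qed.

End CarryGroup.

(** An alias for the product ring, on which the finite ring structure is
    declared. *)
Definition pair_ring (p : nat) : Type := ('F_p * 'F_p)%type.
HB.instance Definition _ p := GRing.ComNzRing.on (pair_ring p).
HB.instance Definition _ p := Finite.on (pair_ring p).

(** The third and fourth generators are taken in A. *)
Lemma carry_satisfies (d : carry_data) w k (m3 m4 : cd_A d) :
    let p := cd_p d in
    (forall m, exists i j, m = m3 *+ i + m4 *+ j)%R ->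
    (m4 *+ p = 0)%R -> cd_D m4 = 0%R ->
    match k with
    | 3 => [/\ cd_z1 d = m4, cd_z2 d = 0, cd_c d = m3, cd_D m3 = 0 & m3 *+ p = 0]
    | 4 => [/\ cd_z1 d = m3, cd_z2 d = m4, cd_c d = m4, cd_D m3 = 0 & m3 *+ p = 0]
    | 6 => [/\ cd_z1 d = m3, cd_z2 d = 0, cd_c d = m4, cd_D m3 = 0 & m3 *+ p = m4]
    | 7 => [/\ cd_z1 d = 0, cd_z2 d = 0, cd_c d = m3, cd_D m3 = m4 & m3 *+ p = 0]
    | 8 => [/\ cd_z1 d = m4, cd_z2 d = 0, cd_c d = m3, cd_D m3 = m4 & m3 *+ p = 0]
    | 9 => [/\ cd_z1 d = 0, cd_z2 d = m4, cd_c d = m3, cd_D m3 = m4 & m3 *+ p = 0]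
    | 10 => [/\ cd_z1 d = 0, cd_z2 d = m4 *+ w, cd_c d = m3, cd_D m3 = m4
              & m3 *+ p = 0]
    | 11 => [/\ cd_z1 d = m4, cd_z2 d = 0, cd_c d = 0, cd_D m3 = 0 & m3 *+ p = 0]
    | 12 => [/\ cd_z1 d = 0, cd_z2 d = 0, cd_c d = m4, cd_D m3 = 0 & m3 *+ p = 0]
    | 13 => [/\ cd_z1 d = m4, cd_z2 d = 0, cd_c d = m4, cd_D m3 = 0 & m3 *+ p = 0]
    | 14 => [/\ cd_z1 d = 0, cd_z2 d = 0, cd_c d = m4, cd_D m3 = 0 & m3 *+ p = m4]
    | _ => False
    end%R ->
  satisfies p w k [set: carry_group d].
Proof.
move=> p gen34 m4p Dm4 Rk.
exists (quadruple (carry_x1 d) (carry_x2 d) (carry_emb m3) (carry_emb m4)).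
split; first exact: carry_gen.
do 15?[case: k Rk => [|k] Rk //]; case: Rk => Ez1 Ez2 Ec ED Ep;
  apply/pc_relationsP; rewrite /rhs /quadruple /=
  carry_x1_expp carry_x2_expp !carry_embX carry_comm21 !carry_comm_emb1
  !carry_comm_emb2 !carry_comm_emb m4p Dm4 Ez1 Ez2 Ec ED Ep; split => //.
Qed.

(** * Models of the listed groups *)

Section Models.
Variables (p w : nat).
Hypotheses (p_pr : prime p) (odd_p : odd p).
Let p_gt0 := prime_gt0 p_pr.
Let p_gt1 := prime_gt1 p_pr.

Section PairData.
Import GRing.Theory.
Local Open Scope ring_scope.
Local Notation B := (pair_ring p).
(** In the models with elementary A the third and fourth generators are the
    canonical basis of A, and [shear] maps the former to the latter. *)
Definition e3 : B := (1, 0).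
Definition e4 : B := (0, 1).
Definition shear (m : B) : B := (0, m.1).

Fact pair_mulrn (x y : 'F_p) n : ((x, y) : B) *+ n = (x *+ n, y *+ n).
Proof. by elim: n => // n IHn; rewrite !mulrS IHn. Qed.
Fact Fp_mulrp (x : 'F_p) : x *+ p = 0.
Proof. by rewrite -mulr_natr pchar_Fp_0 // mulr0. Qed.
Fact pair_mulrp (m : B) : m *+ p = 0.
Proof. by case: m => x y; rewrite pair_mulrn !Fp_mulrp. Qed.
Fact shearD m n : shear (m + n) = shear m + shear n.
Proof. by rewrite /shear -{1}(addr0 (0 : 'F_p)). Qed.
Fact shear2 m : shear (shear m) = 0. Proof. by []. Qed.
Fact shear_p m : shear m *+ p = 0. Proof. exact: pair_mulrp. Qed.

Fact shear_e4 a : shear (e4 *+ a) = 0.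
Proof. by rewrite /e4 pair_mulrn /shear /= mul0rn. Qed.

Definition class2_data (c z1 z2 : B) : carry_data :=
  @CarryData p B (fun=> 0) c z1 z2 p_gt0 odd_p (fun _ _ => esym (addr0 0))
    (fun=> erefl) (fun=> mul0rn _ p) (pair_mulrp c) erefl erefl.

Definition maxclass_data (a b : nat) : carry_data :=
  @CarryData p B shear e3 (e4 *+ a) (e4 *+ b) p_gt0 odd_p shearD shear2 shear_p
    (pair_mulrp e3) (shear_e4 a) (shear_e4 b).

Fact pair_gen (m : B) : exists i j, m = e3 *+ i + e4 *+ j.
Proof.
case: m => x y; exists (val x), (val y); rewrite !pair_mulrn !mul0rn.
by rewrite /GRing.add /= /add_pair /= addr0 add0r !natr_Zp.
Qed.

Fact card_pair_ring : #|{: B}| = (p * p)%N.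
Proof. by rewrite card_prod !card_Fp. Qed.

End PairData.
Section CyclicData.
Import GRing.Theory.
Local Open Scope ring_scope.
Local Notation B := 'Z_(p ^ 2).

Let p2_gt1 : (1 < p ^ 2)%N. Proof. by rewrite (ltn_exp2l 0). Qed.

Fact Zp2_mulrp : (p%:R : B) *+ p = 0.
Proof. by rewrite -mulrnA mulnn pchar_Zp. Qed.

(** In the models with cyclic A the third generator is 1 and the fourth is p. *)
Definition cyclic_center_data (a : nat) : carry_data :=
  @CarryData p B (fun=> 0) p%:R a%:R 0 p_gt0 odd_p (fun _ _ => esym (addr0 0))
    (fun=> erefl) (fun=> mul0rn _ p) Zp2_mulrp erefl erefl.

Fact Zp2_gen (m : B) : exists i j, m = 1 *+ i + p%:R *+ j.
Proof. by exists (val m), 0%N; rewrite mulr0n addr0 natr_Zp. Qed.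

Fact card_Zp2 : #|{: B}| = (p * p)%N.
Proof. by rewrite card_ord Zp_cast. Qed.

End CyclicData.

Definition carry_model (d : carry_data) : {gT : finGroupType & {group gT}} :=
  existT (fun gT : finGroupType => {group gT}) (carry_group d) [set: carry_group d]%G.

(** The default value is the elementary abelian group, the fifteenth of the
    list. *)
Definition listed_model (k : nat) : {gT : finGroupType & {group gT}} :=
  match k with
  | 1 => existT (fun gT : finGroupType => {group gT}) _ (Zp_group (p ^ 4))
  | 2 => existT (fun gT : finGroupType => {group gT}) _
           (setX_group (Zp_group (p ^ 2)) (Zp_group (p ^ 2)))
  | 3 => carry_model (class2_data e3 e4 0%R)
  | 4 => carry_model (class2_data e4 e3 e4)
  | 5 => existT (fun gT : finGroupType => {group gT}) _
           (setX_group (Zp_group (p ^ 3)) (Zp_group p))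
  | 6 => carry_model (cyclic_center_data 1)
  | 7 => carry_model (maxclass_data 0 0)
  | 8 => carry_model (maxclass_data 1 0)
  | 9 => carry_model (maxclass_data 0 1)
  | 10 => carry_model (maxclass_data 0 w)
  | 11 => carry_model (class2_data 0%R e4 0%R)
  | 12 => carry_model (class2_data e4 0%R 0%R)
  | 13 => carry_model (class2_data e4 e4 0%R)
  | 14 => carry_model (cyclic_center_data 0)
  | _ => existT (fun gT : finGroupType => {group gT}) _
           (setXn_group (fun _ : 'I_4 => Zp_group p))
  end.

Lemma card_listed_model k : #|projT2 (listed_model k)| = (p ^ 4)%N.
Proof.
have p4E : (p * p * (p * p) = p ^ 4)%N by rewrite !expnS expn0 muln1 !mulnA.
have card_class2 c z1 z2 :
    #|[set: carry_group (class2_data c z1 z2)]| = (p ^ 4)%N.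
  by rewrite card_carry_group /= card_pair_ring // p4E.
have card_max a b : #|[set: carry_group (maxclass_data a b)]| = (p ^ 4)%N.
  by rewrite card_carry_group /= card_pair_ring // p4E.
have card_cyc a : #|[set: carry_group (cyclic_center_data a)]| = (p ^ 4)%N.
  by rewrite card_carry_group /= card_Zp2 // p4E.
have card_Zpe e : #|Zp (p ^ e)| = (p ^ e)%N by rewrite card_Zp ?expn_gt0 ?p_gt0.
have card_15 : #|setXn (fun _ : 'I_4 => Zp p)| = (p ^ 4)%N.
  by rewrite cardsXn big_const card_ord /= card_Zp // -p4E muln1 !mulnA.
do 16?[case: k => [|k]]; first
  [exact: card_15 | exact: card_class2 | exact: card_max | exact: card_cyc | idtac].
- exact: card_Zpe.
- by rewrite /= cardsX card_Zpe -expnD.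
- by rewrite /= cardsX card_Zpe card_Zp // -expnSr.
Qed.

Fact prod_expg (gT1 gT2 : finGroupType) (x : gT1) (y : gT2) n :
  (x, y) ^+ n = (x ^+ n, y ^+ n).
Proof. by elim: n => // n IHn; rewrite !expgS IHn. Qed.

Lemma setX_Zp_gen m n x3 x4 : 1 < m -> 1 < n ->
    let x1 : 'Z_m * 'Z_n := (Zp1, 1) in let x2 := (1, Zp1) in
  [/\ <<[set x1; x2; x3; x4]>> = setX (Zp m) (Zp n), x1 ^+ m = 1 & x2 ^+ n = 1].
Proof.
move=> m_gt1 n_gt1 x1 x2; rewrite /Zp m_gt1 n_gt1; split.
- apply/eqP; rewrite eqEsubset; apply/andP; split.
    by apply/subsetP=> u _; rewrite !inE.
  apply/subsetP=> [[u v]] _.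
  have [i ->] : exists i, u = Zp1 ^+ i by apply/cycleP; rewrite -Zp_cycle inE.
  have [j ->] : exists j, v = Zp1 ^+ j by apply/cycleP; rewrite -Zp_cycle inE.
  have -> : (Zp1 ^+ i, Zp1 ^+ j) = x1 ^+ i * x2 ^+ j :> 'Z_m * 'Z_n.
    rewrite !prod_expg !expg1n; congr (_, _); [exact/esym/mulg1 | exact/esym/mul1g].
  by rewrite groupM ?groupX // mem_gen // !inE eqxx ?orbT.
- rewrite prod_expg expg1n; congr (_, _); exact: pchar_Zp.
- rewrite prod_expg expg1n; congr (_, _); exact: pchar_Zp.
Qed.

Fact abelian_Zp n : abelian (Zp n).
Proof. by apply/centsP=> x _ y _; apply: Zp_mulgC. Qed.

Fact abelian_setX_Zp m n : abelian (setX (Zp m) (Zp n)).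
Proof.
by apply/centsP=> [[x y]] _ [x' y'] _; congr (_, _); apply: Zp_mulgC.
Qed.

Lemma listed_model_satisfies k : 1 <= k <= 14 ->
  satisfies p w k (projT2 (listed_model k)).
Proof.
have pair_sat c z1 z2 l := @carry_satisfies (class2_data c z1 z2) w l e3 e4
  (@pair_gen) (pair_mulrp e4) erefl.
have max_sat a b l := @carry_satisfies (maxclass_data a b) w l e3 e4
  (@pair_gen) (pair_mulrp e4) erefl.
have cyc_sat a l := @carry_satisfies (cyclic_center_data a) w l 1%R p%:R%R
  (@Zp2_gen) Zp2_mulrp erefl.
have e3p := pair_mulrp e3.
do 15?[case: k => [|k] //] => _.
- have p4 : 1 < p ^ 4 by rewrite (ltn_exp2l 0).
  pose x : 'Z_(p ^ 4) := Zp1; pose y := x ^+ p; pose z := y ^+ p; pose t := z ^+ p.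
  apply: (@abelian_satisfies _ p w _ (abelian_Zp _) 1 x y z t); last first.
    by split=> //; rewrite /t /z /y -!expgnA; apply: (pchar_Zp p4).
  apply/eqP; rewrite /= /Zp p4 eqEsubset subsetT /= Zp_cycle cycle_subG.
  by rewrite mem_gen // !inE eqxx.
- have p2 : 1 < p ^ 2 by rewrite (ltn_exp2l 0).
  set H := projT2 _; pose x1 : 'Z_(p ^ 2) * 'Z_(p ^ 2) := (Zp1, 1).
  pose x2 : 'Z_(p ^ 2) * 'Z_(p ^ 2) := (1, Zp1).
  have [gen12 x1p x2p] := setX_Zp_gen (x1 ^+ p) (x2 ^+ p) p2 p2.
  apply: (abelian_satisfies w (H := H) (abelian_setX_Zp _ _) (k := 2) gen12).
  by split; rewrite // -expgnA.
- by apply: pair_sat.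
- by apply: pair_sat.
- have p3 : 1 < p ^ 3 by rewrite (ltn_exp2l 0).
  set H := projT2 _; pose x1 : 'Z_(p ^ 3) * 'Z_p := (Zp1, 1).
  have [gen12 x1p x2p] := setX_Zp_gen (x1 ^+ p) (x1 ^+ p ^+ p) p3 p_gt1.
  apply: (abelian_satisfies w (H := H) (abelian_setX_Zp _ _) (k := 5) gen12).
  by split; rewrite // -!expgnA.
- by apply: cyc_sat.
- by apply: max_sat.
- by apply: max_sat.
- by apply: max_sat.
- by apply: max_sat.
- by apply: pair_sat.
- by apply: pair_sat.
- by apply: pair_sat.
- by apply: cyc_sat.
Qed.

Lemma listed_model_elementary : p.-abelem (projT2 (listed_model 15)).
Proof.
apply/(abelemP p_pr); split=> [|x _].
  apply/centsP=> x _ y _; apply/ffunP=> i; rewrite !ffunE; exact: Zp_mulgC.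
have xX n : x ^+ n = [ffun i => x i ^+ n].
  by elim: n => [|n IHn]; apply/ffunP=> i; rewrite ?expgS ?IHn !ffunE ?expgS.
apply/ffunP=> i; rewrite xX !ffunE.
have Zp_p (y : 'Z_p) : (y *+ p = 0)%R by rewrite -GRing.mulr_natr pchar_Zp ?GRing.mulr0.
exact: Zp_p.
Qed.

End Models.

(** * Orders of the subgroups generated by a polycyclic sequence *)

Section Span.
Variables (p : nat) (gT : finGroupType).
Hypothesis p_gt1 : 1 < p.

Lemma gen_has_normal_form (s : seq gT) y : pc_sequence p s ->
  y \in <<[set x in s]>> -> has_normal_form p s y.
Proof.
move=> pc_s /gen_prodgP[n [f fs ->]].
apply: (big_ind (fun y => has_normal_form p s y)).
- exact: has_normal_form1.
- by move=> u v; apply: has_normal_formM.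
move=> i _; have := fs i; rewrite inE; elim: (s) => //= x r IHr.
rewrite inE => /predU1P[-> | /IHr]; first exact: has_normal_form_head.
exact: has_normal_form_tail.
Qed.

Lemma has_normal_form_gen (s : seq gT) y :
  has_normal_form p s y -> y \in <<[set x in s]>>.
Proof.
elim: s y => [|x s IHs] y /=; first by move=> ->; apply: group1.
case=> a _ [z /IHs sz ->]; apply: groupM.
  by rewrite groupX // mem_gen // !inE eqxx.
have sub : [set v in s] \subset [set v in x :: s].
  by apply/subsetP=> v; rewrite !inE => ->; rewrite orbT.
exact: subsetP (genS sub) _ sz.
Qed.

(** The elements are the products x^a z with a < p and z in the subgroup generated
    by s. *)
Lemma card_pc_span (x : gT) s : pc_sequence p (x :: s) ->
  #|<<[set y in x :: s]>>| <= p * #|<<[set y in s]>>|.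
Proof.
move=> pc_xs.
have -> : (p * #|<<[set y in s]>>| = #|setX [set: 'I_p] <<[set y in s]>>|)%N.
  by rewrite cardsX cardsT card_ord.
apply: leq_trans (leq_imset_card (fun u : 'I_p * gT => x ^+ u.1 * u.2) _).
apply/subset_leq_card/subsetP=> y /(gen_has_normal_form pc_xs)[a a_p [z sz ->]].
apply/imsetP; exists (Ordinal a_p, z) => //.
by rewrite in_setX inE has_normal_form_gen.
Qed.

End Span.

(** At order p^4 each of the bounds of [card_pc_span] is attained. *)
Lemma relations_chain p w k (gT : finGroupType) (H : {group gT}) (g : nat -> gT) :
    prime p -> #|H| = (p ^ 4)%N -> <<[set g 1%N; g 2; g 3; g 4]>> = H ->
    relations p w k g ->
  [/\ g 4 != 1, g 3 \notin <[g 4]>, #|<<[set g 3; g 4]>>| = (p ^ 2)%N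
    & #|<<[set g 2; g 3; g 4]>>| = (p ^ 3)%N].
Proof.
move=> p_pr oH defH Rg; have p_gt1 := prime_gt1 p_pr.
have pc1 := relations_pc_sequence p_gt1 Rg; have pc2 : pc_sequence p [:: g 2; g 3; g 4].
  by case: pc1.
have pc3 : pc_sequence p [:: g 3; g 4] by case: pc2.
have pc4 : pc_sequence p [:: g 4] by case: pc3.
have := card_pc_span p_gt1 pc1; have := card_pc_span p_gt1 pc2.
have := card_pc_span p_gt1 pc3; have := card_pc_span p_gt1 pc4.
have -> : [set y in [:: g 1%N; g 2; g 3; g 4]] = [set g 1%N; g 2; g 3; g 4].
  by apply/setP=> y; rewrite !inE -?orbA.
have -> : [set y in [:: g 2; g 3; g 4]] = [set g 2; g 3; g 4].
  by apply/setP=> y; rewrite !inE -?orbA.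
have -> : [set y in [:: g 3; g 4]] = [set g 3; g 4].
  by apply/setP=> y; rewrite !inE -?orbA.
have -> : [set y in [:: g 4]] = [set g 4] by apply/setP=> y; rewrite !inE.
have -> : <<[set y in [::]]>> = 1 :> {set gT}.
  by rewrite (_ : [set _ in _] = set0) ?gen0 //; apply/setP=> y; rewrite !inE.
rewrite defH oH cards1 muln1.
set n4 := #|_|; set n3 := #|<<[set g 3; _]>>|; set n2 := #|_| => h4 h3 h2 h1.
have p_gt0 := ltnW p_gt1.
have h2' : p ^ 3 <= n2 by rewrite -(leq_pmul2l p_gt0) -expnS.
have h3' : p ^ 2 <= n3.
  by rewrite -(leq_pmul2l p_gt0) -expnS; apply: leq_trans h2.
have h4' : p ^ 1 <= n4.
  by rewrite -(leq_pmul2l p_gt0) -expnS; apply: leq_trans h3.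
have e3 : n3 = (p ^ 2)%N.
  by apply/eqP; rewrite eqn_leq h3' andbT (leq_trans h3) // expnS leq_mul2l h4 orbT.
have e2 : n2 = (p ^ 3)%N.
  by apply/eqP; rewrite eqn_leq h2' andbT (leq_trans h2) // e3 -expnS.
split=> //.
  apply: contraTneq h4' => g41; rewrite /n4 g41 -/(cycle 1) cycle1 cards1.
  by rewrite expn1 -ltnNge.
apply/negP=> g34; have: n3 <= n4.
  by apply: subset_leq_card; rewrite gen_subG subUset !sub1set g34 cycle_id.
by rewrite e3 leqNgt (leq_ltn_trans h4) // -{1}(expn1 p) ltn_exp2l.
Qed.

(** * Recovering the index from the group *)

Section Index.
Variables (p : nat) (gT : finGroupType).

Definition has_exponent (A : {set gT}) (n : nat) : bool :=
  [forall x in A, x ^+ n == 1].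

(** A group isomorphic to two members of the list satisfies both systems of
    relations; each of them determines this value, so the indices agree. *)
Definition list_index (H : {group gT}) : nat :=
  if abelian H then
    if has_exponent H p then 15
    else if ~~ has_exponent H (p ^ 3) then 1%N
    else if ~~ has_exponent H (p ^ 2) then 5
    else if [exists z in H, [forall x in H, x ^+ p \in <[z ^+ p]>]] then 11 else 2
  else if H^`(1) \subset 'Z(H) then
    if has_exponent H p then 12
    else if ~~ has_exponent H (p ^ 2) then 6
    else if [forall x in H, x ^+ p \in H^`(1)] then
      if has_exponent 'Z(H) p then 13 else 14
    else if [exists x in H, (x ^+ p != 1) && (x ^+ p \in H^`(1))] then 4 else 3
  else if has_exponent H p then 7
  else if has_exponent 'C_H(H^`(1)) p then 8
  else if [exists x in H, exists y in 'C_H(H^`(1)),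
             (y ^+ p != 1) && (y ^+ p == [~ [~ y, x], x])] then 9
  else 10.

Lemma has_exponentP (A : {set gT}) n :
  reflect {in A, forall x, x ^+ n = 1} (has_exponent A n).
Proof.
apply: (iffP forall_inP) => An x Ax; first exact/eqP/An.
by rewrite An.
Qed.

Lemma not_has_exponent (A : {set gT}) n x :
  x \in A -> x ^+ n != 1 -> has_exponent A n = false.
Proof. by move=> Ax; apply: contraNF => /has_exponentP/(_ x Ax)->. Qed.

End Index.

Section FourGenerators.
Variables (gT : finGroupType) (H : {group gT}) (g : nat -> gT).
Hypothesis defH : <<[set g 1%N; g 2; g 3; g 4]>> = H.

Lemma gen4P (P : gT -> Prop) : P (g 1%N) -> P (g 2) -> P (g 3) -> P (g 4) ->
  {in [set g 1%N; g 2; g 3; g 4], forall x, P x}.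
Proof. by move=> P1 P2 P3 P4 x; rewrite !inE -!orbA => /or4P[] /eqP->. Qed.

Lemma gen4_center x : x \in H ->
    commute x (g 1%N) -> commute x (g 2) -> commute x (g 3) -> commute x (g 4) ->
  x \in 'Z(H).
Proof.
move=> Hx c1 c2 c3 c4; apply/centerP; split=> // y Hy.
suff: H \subset 'C[x] by move/subsetP/(_ y Hy)/cent1P.
rewrite -defH gen_subG; apply/subsetP; apply: gen4P; exact/cent1P.
Qed.

Lemma gen4_der1 (N : {group gT}) : N <| H ->
    [~ g 2, g 1%N] \in N -> [~ g 3, g 1%N] \in N -> [~ g 4, g 1%N] \in N ->
    [~ g 3, g 2] \in N -> [~ g 4, g 2] \in N -> [~ g 4, g 3] \in N ->
  H^`(1) \subset N.
Proof.
move=> nNH c21 c31 c41 c32 c42 c43; apply: (der1_gen_sub defH nNH).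
have inv x y : [~ x, y] \in N -> [~ y, x] \in N by rewrite -invg_comm groupV.
by move=> x y; move: x; apply: gen4P; move: y; apply: gen4P;
  rewrite ?commgg ?group1 //; apply: inv.
Qed.

End FourGenerators.

(** H / Z is not cyclic, and the centre of a p-group is not trivial. *)
Lemma nonabelian_center p (gT : finGroupType) (H : {group gT}) :
    prime p -> #|H| = (p ^ 4)%N -> ~~ abelian H ->
  #|'Z(H)| = p \/ #|'Z(H)| = (p ^ 2)%N.
Proof.
move=> p_pr oH nabH; have p_gt1 := prime_gt1 p_pr.
have pH : p.-group H by rewrite /pgroup oH pnatX pnat_id.
have [e oZ] := p_natP (pgroupS (center_sub H) pH).
have oHZ : (#|'Z(H)| * #|H / 'Z(H)| = p ^ 4)%N.
  by rewrite card_quotient ?gFnorm // Lagrange ?center_sub.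
have [f of_] := p_natP (quotient_pgroup 'Z(H) pH); rewrite of_ in oHZ.
move: oHZ; rewrite oZ -expnD => /(expnI p_gt1) ef4.
have e_gt0 : 0 < e.
  rewrite lt0n; apply: contra nabH => /eqP e0; rewrite e0 in oZ.
  have /eqP := card1_trivg oZ; rewrite (center_nil_eq1 (pgroup_nil pH)) => /eqP->.
  exact: abelian1.
have f_gt1 : 1 < f.
  rewrite ltnNge; apply: contra nabH => f_le1.
  apply: cyclic_center_factor_abelian.
  case: f f_le1 of_ {ef4} => [|[|//]] _ of_; last by rewrite prime_cyclic // of_.
  by rewrite (card1_trivg of_) cyclic1.
have [-> | ->] : e = 1%N \/ e = 2 by lia.
  by left; rewrite expn1.
by right.
Qed.

Section IndexOfRelations.
Variables (p : nat) (gT : finGroupType) (H : {group gT}) (g : nat -> gT).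
Hypotheses (p_pr : prime p) (p_gt3 : 3 < p) (oH : #|H| = (p ^ 4)%N).
Hypothesis defH : <<[set g 1%N; g 2; g 3; g 4]>> = H.

Let Hg := (fun i => @gen4_mem _ _ g i defH).
Let p_gt1 := prime_gt1 p_pr.
Let odd_p : odd p. Proof. by case: (even_prime p_pr) p_gt3 => [->|]. Qed.

(** The second and eleventh groups are separated by whether the p-th powers lie
    in one cyclic group generated by a p-th power, that is by the rank of the
    power map. *)
Lemma index_abelian w k : relations p w k g -> k \in [:: 1; 2; 5; 11]%N ->
  list_index p H = k.
Proof.
move=> Rg; have [n4 n34 o34 _] := relations_chain p_pr oH defH Rg.
move=> k_ab; have abH : abelian H.
  apply/derG1P/trivgP; apply: (gen4_der1 defH (normal1 H));
  move: k_ab Rg; rewrite !inE => /or4P[] /eqP-> /pc_relationsP; rewrite /rhs /=;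
  by case=> _ [[c21 c31 c41] [c32 c42 c43]]; rewrite (c21, c31, c41, c32, c42, c43) eqxx.
have expM n : {in H &, {morph (fun v => v ^+ n) : v1 v2 / v1 * v2}}.
  by move=> v1 v2 H1 H2; apply: expgMn; apply: (centsP abH).
have exp_gen n : g 1%N ^+ n = 1 -> g 2 ^+ n = 1 -> g 3 ^+ n = 1 -> g 4 ^+ n = 1 ->
    has_exponent H n.
  move=> e1 e2 e3 e4; apply/has_exponentP=> x Hx; apply/set1P.
  apply: (expg_gen_sub (N := 1%G) defH (expM n)) Hx.
  by apply: gen4P; rewrite (e1, e2, e3, e4) group1.
have n3 : g 3 != 1 by apply: contraNneq n34 => ->; apply: group1.
have H1 : g 1%N \in H by apply: Hg.
have p3E (x : gT) : x ^+ (p ^ 3) = x ^+ p ^+ p ^+ p by rewrite -!expgnA.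
have p2E (x : gT) : x ^+ (p ^ 2) = x ^+ p ^+ p by rewrite -!expgnA.
rewrite /list_index abH.
move: k_ab Rg; rewrite !inE => /or4P[] /eqP-> /pc_relationsP; rewrite /rhs /=;
  case=> [[R1 R2 R3 R4]] _.
- rewrite (not_has_exponent H1) ?R1; last first.
    by apply: contraNneq n3 => g2; rewrite -R2 g2 expg1n.
  by rewrite (not_has_exponent H1) // p3E R1 R2 R3.
- rewrite (not_has_exponent H1) ?R1 //.
  rewrite exp_gen ?p3E ?R1 ?R2 ?R3 ?R4 ?expg1n //=.
  rewrite exp_gen ?p2E ?R1 ?R2 ?R3 ?R4 ?expg1n //=.
  case: exists_inP => // [[z Hz /forall_inP zP]].
  have : <<[set g 3; g 4]>> \subset <[z ^+ p]>.
    rewrite gen_subG subUset !sub1set -R1 -R2 !zP ?Hg //.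
  move/subset_leq_card; rewrite o34 leqNgt -orderE (@leq_ltn_trans p) //.
    apply: dvdn_leq; rewrite ?prime_gt0 // order_dvdn -p2E.
    suff /has_exponentP-> : has_exponent H (p ^ 2) by [].
    by rewrite exp_gen ?p2E ?R1 ?R2 ?R3 ?R4 ?expg1n.
  by rewrite -{1}(expn1 p) ltn_exp2l.
- rewrite (not_has_exponent H1) ?R1 //.
  rewrite exp_gen ?p3E ?R1 ?R2 ?R3 ?R4 ?expg1n //=.
  by rewrite (not_has_exponent H1) // p2E R1 R3.
rewrite (not_has_exponent H1) ?R1 //.
rewrite exp_gen ?p3E ?R1 ?R2 ?R3 ?R4 ?expg1n //=.
rewrite exp_gen ?p2E ?R1 ?R2 ?R3 ?R4 ?expg1n //=.
case: exists_inP => // [[]]; exists (g 1%N) => //; apply/forall_inP.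
rewrite R1; apply: (expg_gen_sub defH (expM p)).
by apply: gen4P; rewrite (R1, R2, R3, R4) ?group1 ?cycle_id.
Qed.

(** H' is generated by c = [g_2, g_1], which is g_3 for the third group and g_4
    otherwise, and the p-th powers are read off on generators since the power map
    is a morphism. *)
Lemma index_class2 w k : relations p w k g -> k \in [:: 3; 4; 6; 12; 13; 14]%N ->
  list_index p H = k.
Proof.
move=> Rg k_c2; have [n4 n34 o34 _] := relations_chain p_pr oH defH Rg.
have [H1 H2 H3 H4] : [/\ g 1%N \in H, g 2 \in H, g 3 \in H & g 4 \in H].
  by split; apply: Hg.
have n3 : g 3 != 1 by apply: contraNneq n34 => ->; apply: group1.
pose c := if k == 3 then g 3 else g 4.
have nc : c != 1 by rewrite /c; case: ifP.
have [c21 [Z3 Z4]] : [~ g 2, g 1%N] = c /\ g 3 \in 'Z(H) /\ g 4 \in 'Z(H).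
  have : [~ g 2, g 1%N] = c /\ [/\ [~ g 3, g 1%N] = 1, [~ g 4, g 1%N] = 1,
      [~ g 3, g 2] = 1, [~ g 4, g 2] = 1 & [~ g 4, g 3] = 1].
    by rewrite /c; move: k_c2 Rg; rewrite !in_cons orbF;
      do 5?[case/orP; last move]; move/eqP=> -> /pc_relationsP; rewrite /rhs /=;
      case=> _ [[-> -> ->] [-> -> ->]].
  case=> -> [c31 c41 c32 c42 c43]; split=> //.
  split; apply: (gen4_center defH) => //; apply/commgP; rewrite ?commgg ?c31 ?c32
    ?c41 ?c42 ?c43 // -invg_comm ?c43 invg1 //.
have Zc : c \in 'Z(H) by rewrite /c; case: ifP.
have cp : c ^+ p = 1.
  by rewrite /c; move: k_c2 Rg; rewrite !in_cons orbF;
    do 5?[case/orP; last move]; move/eqP=> -> /pc_relationsP; rewrite /rhs /=;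
    case=> [[_ _ R3 R4]] _.
have nZc : <[c]> <| H by rewrite sub_center_normal // cycle_subG.
have sH'c : H^`(1) \subset <[c]>.
  apply: (gen4_der1 defH nZc); rewrite ?c21 ?cycle_id //.
  - by rewrite (commg_center Z3 H1) group1.
  - by rewrite (commg_center Z4 H1) group1.
  - by rewrite (commg_center Z3 H2) group1.
  - by rewrite (commg_center Z4 H2) group1.
  - by rewrite (commg_center Z4 H3) group1.
have H'c : c \in H^`(1) by rewrite -c21 mem_commg.
have sH'Z : H^`(1) \subset 'Z(H) by rewrite (subset_trans sH'c) // cycle_subG.
have nabH : ~~ abelian H.
  by apply: contra nc => abH; rewrite -c21; apply/commgP; apply: (centsP abH).
have expM : {in H &, {morph (fun x => x ^+ p) : x y / x * y}}.
  apply: (class2_expgM sH'Z odd_p) => x y Hx Hy.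
  by apply: (cycle_expgp cp); rewrite (subsetP sH'c) // mem_commg.
have p2E (x : gT) : x ^+ (p ^ 2) = x ^+ p ^+ p by rewrite -!expgnA.
rewrite /list_index (negPf nabH) sH'Z.
have exp_sub (N : {group gT}) : g 1%N ^+ p \in N -> g 2 ^+ p \in N ->
    g 3 ^+ p \in N -> g 4 ^+ p \in N -> {in H, forall x, x ^+ p \in N}.
  by move=> N1 N2 N3 N4; apply: (expg_gen_sub defH expM); apply: gen4P.
have phi2 (z : gT) : z ^+ p = 1 -> {in H, forall x, x ^+ p \in <[z]>} ->
    has_exponent H (p ^ 2).
  move=> zp Hz; apply/has_exponentP=> x Hx; rewrite p2E.
  exact: cycle_expgp zp (Hz x Hx).
pose N34 := <<[set g 3; g 4]>>%G.
have sN34H : N34 \subset H by rewrite gen_subG subUset !sub1set H3.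
have exp34 : g 3 ^+ p = 1 -> g 4 ^+ p = 1 -> {in N34, forall x, x ^+ p = 1}.
  move=> e3 e4 x Nx; apply/set1P.
  have expM34 : {in N34 &, {morph (fun x => x ^+ p) : x y / x * y}}.
    by move=> u v Nu Nv; apply: expM; apply: (subsetP sN34H).
  apply: (expg_gen_sub (S := [set g 3; g 4]) (G := N34) (N := 1%G) _ expM34) Nx => //.
  by move=> u; rewrite !inE => /orP[] /eqP->; rewrite (e3, e4).
move: k_c2 (Rg) @c nc c21 Zc cp nZc sH'c H'c; rewrite !in_cons orbF.
do 5?[case/orP; last move]; move/eqP=> -> /pc_relationsP; rewrite /rhs /=;
  case=> [[R1 R2 R3 R4]] _ nc c21 Zc cp nZc sH'c H'c.
- rewrite (not_has_exponent H1) ?R1 //.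
  have H4p : {in H, forall x, x ^+ p \in <[g 4]>}.
    by apply: exp_sub; rewrite ?R1 ?R2 ?R3 ?R4 ?group1 ?cycle_id.
  rewrite (phi2 _ R4 H4p) /=.
  have n43 : g 4 \notin <[g 3]>.
    apply: contra n34 => /(prime_cycle_gen p_pr cp)/(_ n4)[j ->].
    exact: mem_cycle.
  rewrite ifF; last first.
    apply/negbTE/forall_inPn; exists (g 1%N) => //; rewrite R1.
    by apply: contra n43; apply: (subsetP sH'c).
  rewrite ifF //; apply/negbTE/exists_inPn=> x Hx; rewrite negb_and negbK.
  case: eqVneq => //= nxp; apply: contra n43 => /(subsetP sH'c) x3.
  have [j ->] := prime_cycle_gen p_pr R4 (H4p x Hx) nxp.
  by rewrite groupX.
- rewrite (not_has_exponent H1) ?R1 //.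
  have HN : {in H, forall x, x ^+ p \in N34}.
    by apply: exp_sub; rewrite ?R1 ?R2 ?R3 ?R4 ?group1 // mem_gen // !inE eqxx ?orbT.
  have -> : has_exponent H (p ^ 2).
    by apply/has_exponentP=> x Hx; rewrite p2E exp34 ?HN.
  rewrite /= ifF; last first.
    apply/negbTE/forall_inPn; exists (g 1%N) => //; rewrite R1.
    by apply: contra n34; apply: (subsetP sH'c).
  by rewrite ifT //; apply/exists_inP; exists (g 2); rewrite // R2 n4.
- rewrite (not_has_exponent H1) ?R1 //.
  by rewrite (not_has_exponent H1) // p2E R1 R3.
- rewrite (_ : has_exponent H p) //; apply/has_exponentP=> x Hx; apply/set1P.
  by apply: (exp_sub 1%G) Hx; rewrite (R1, R2, R3, R4) group1.
- rewrite (not_has_exponent H1) ?R1 //.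
  have H4p : {in H, forall x, x ^+ p \in <[g 4]>}.
    by apply: exp_sub; rewrite ?R1 ?R2 ?R3 ?R4 ?group1 ?cycle_id.
  rewrite (phi2 _ R4 H4p) /= ifT; last first.
    apply/forall_inP=> x Hx; apply: subsetP (H4p x Hx).
    by rewrite cycle_subG.
  rewrite ifT //; apply/has_exponentP=> x Zx; apply: exp34 => //.
  suff -> : N34 = 'Z(H) :> {set gT} by [].
  apply/eqP; rewrite eqEcard gen_subG subUset !sub1set Z3 Z4 /= o34.
  by have [->|->] := nonabelian_center p_pr oH nabH; rewrite // -{1}(expn1 p) leq_exp2l.
- rewrite (not_has_exponent H3) ?R3 //.
  have H4p : {in H, forall x, x ^+ p \in <[g 4]>}.
    by apply: exp_sub; rewrite ?R1 ?R2 ?R3 ?R4 ?group1 ?cycle_id.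
  rewrite (phi2 _ R4 H4p) /= ifT; last first.
    apply/forall_inP=> x Hx; apply: subsetP (H4p x Hx).
    by rewrite cycle_subG.
  by rewrite (not_has_exponent Z3) // R3.
Qed.

(** A = <<g_2, g_3, g_4>> is the centralizer of H', so the tests on that
    centralizer are tests on A. In the tenth group x in g_1^r A and
    y in g_2^t <<g_3, g_4>> give [[y, x], x] = g_4^(r^2 t) and y^p = g_4^(w t),
    which cannot be equal and nontrivial as w is not a square. *)
Lemma index_maxclass w k : (forall r, r ^ 2 <> w %[mod p]) ->
    relations p w k g -> k \in [:: 7; 8; 9; 10]%N ->
  list_index p H = k.
Proof.
move=> nsq Rg k_mc; have [n4 n34 o34 oA] := relations_chain p_pr oH defH Rg.
have [H1 H2 H3 H4] : [/\ g 1%N \in H, g 2 \in H, g 3 \in H & g 4 \in H].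
  by split; apply: Hg.
have [[c21 c31 c41] [c32 c42 c43] R3 R4] : [/\
    [/\ [~ g 2, g 1%N] = g 3, [~ g 3, g 1%N] = g 4 & [~ g 4, g 1%N] = 1],
    [/\ [~ g 3, g 2] = 1, [~ g 4, g 2] = 1 & [~ g 4, g 3] = 1],
    g 3 ^+ p = 1 & g 4 ^+ p = 1].
  move: k_mc Rg; rewrite !inE => /or4P[] /eqP-> /pc_relationsP; rewrite /rhs /=;
  by case=> [[_ _ -> ->]] [[-> -> ->] [-> -> ->]].
pose A := <<[set g 2; g 3; g 4]>>%G.
have sAH : A \subset H by rewrite gen_subG !subUset !sub1set H2 H3.
have A2 : g 2 \in A by rewrite mem_gen // !inE eqxx.
have A3 : g 3 \in A by rewrite mem_gen // !inE eqxx ?orbT.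
have A4 : g 4 \in A by rewrite mem_gen // !inE eqxx ?orbT.
have abA : abelian A.
  rewrite abelian_gen; apply/centsP=> x + y; rewrite !inE -!orbA.
  by move=> /or3P[] /eqP-> /or3P[] /eqP->; first [exact: commute_refl
    | apply/commgP; rewrite ?c32 ?c42 ?c43 // -invg_comm ?c32 ?c42 ?c43 ?invg1].
have cA x y : x \in A -> y \in A -> commute x y.
  by move=> Ax Ay; apply: (centsP abA).
have Z4 : g 4 \in 'Z(H).
  by apply: (gen4_center defH) => //; apply/commgP; rewrite ?commgg ?c41 ?c42 ?c43.
have nZ3 : g 3 \notin 'Z(H).
  by apply: contra n4 => Z3; rewrite -c31 (commg_center Z3 H1).
have H'3 : g 3 \in H^`(1) by rewrite -c21 mem_commg.
have nabH : ~~ abelian H.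
  apply: contra nZ3 => abH; apply/centerP; split=> // y Hy.
  exact: (centsP abH).
have nsH'Z : ~~ (H^`(1) \subset 'Z(H)).
  by apply: contra nZ3 => /subsetP->.
have oZ : #|'Z(H)| = p.
  have [//|oZ] := nonabelian_center p_pr oH nabH.
  by case/negP: nsH'Z; apply: (der1_sub_center p_pr oH oZ).
have nsAH : A <| H := maxclass_abelian_normal p_pr oH sAH oA.
have nA1 : g 1%N \notin A.
  apply: contraL (leqnn #|A|) => A1; rewrite -ltnNge oA.
  have : H \subset A by rewrite -defH gen_subG; apply/subsetP; apply: gen4P.
  by move/subset_leq_card; rewrite oH oA leq_exp2l.
have sH'A : H^`(1) \subset A.
  apply: (der1_min (normal_norm nsAH)); apply: cyclic_abelian.
  by rewrite prime_cyclic // card_quotient ?normal_norm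
    // (index_maxclass_abelian p_pr oH sAH oA).
have CA y : y \in 'C_H(H^`(1)) -> y \in A.
  case/setIP=> Hy /centP cy; apply: contraNT nZ3 => nAy.
  by apply: (comm1_center p_pr oH sAH abA oA Hy nAy A3); apply/commute_sym/cy.
have AC y : y \in A -> y \in 'C_H(H^`(1)).
  move=> Ay; apply/setIP; split; first exact: (subsetP sAH).
  by apply/centP=> z /(subsetP sH'A) Az; apply: cA.
have expA (N : {group gT}) : g 2 ^+ p \in N -> g 3 ^+ p \in N -> g 4 ^+ p \in N ->
    {in A, forall y, y ^+ p \in N}.
  move=> N2 N3 N4; apply: (expg_gen_sub (S := [set g 2; g 3; g 4])) => //.
    by move=> u v Au Av; apply: expgMn; apply: cA.
  by move=> u; rewrite !inE -!orbA => /or3P[] /eqP->.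
have pc1 := relations_pc_sequence p_gt1 Rg.
have pc2 : pc_sequence p [:: g 2; g 3; g 4] by case: pc1.
have Hnf h : h \in H -> exists r a, a \in A /\ h = g 1%N ^+ r * a.
  move=> Hh; have [|r _ [a nfa ->]] := gen_has_normal_form p_gt1 (y := h) pc1.
    apply: etrans Hh; rewrite -defH; congr (_ \in <<_>>).
    by apply/setP=> u; rewrite !inE -!orbA.
  exists r, a; split=> //.
  have := @has_normal_form_gen p _ [:: g 2; g 3; g 4] a nfa; congr (_ \in <<_>>).
  by apply/setP=> u; rewrite !inE -!orbA.
rewrite /list_index (negPf nabH) (negPf nsH'Z).
have C2 := AC _ A2.
move: k_mc (Rg); rewrite !inE => /or4P[] /eqP-> /pc_relationsP; rewrite /rhs /=;
  case=> [[R1 R2 _ _]] _.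
- rewrite (_ : has_exponent H p) //; apply/has_exponentP=> h Hh.
  have expA1 a : a \in A -> a ^+ p = 1.
    move=> Aa; apply/set1P; apply: (expA 1%G) Aa; by rewrite (R2, R3, R4) group1.
  have [r [a [Aa def_h]]] := Hnf h Hh; rewrite def_h.
  have [Ar | nAr] := boolP (g 1%N ^+ r \in A); first by rewrite expA1 ?groupM.
  rewrite (maxclass_expM p_pr p_gt3 oH oZ sAH abA oA _ Aa nAr) ?groupX //.
  by rewrite (expA1 a Aa) expgnAC R1 expg1n mulg1.
- rewrite (not_has_exponent H1) ?R1 // (_ : has_exponent _ p) //.
  apply/has_exponentP=> y /CA Ay; apply/set1P.
  by apply: (expA 1%G) Ay; rewrite (R2, R3, R4) group1.
- rewrite (not_has_exponent H2) ?R2 // (not_has_exponent C2) ?R2 // ifT //.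
  apply/exists_inP; exists (g 1%N) => //; apply/exists_inP; exists (g 2) => //.
  by rewrite R2 n4 c21 c31 /=.
have n4w : g 4 ^+ w != 1.
  rewrite -order_dvdn (order_eq_prime p_pr R4 n4); apply/negP=> p_w.
  by apply: (nsq p); rewrite (eqP p_w) -mulnn modnMl.
rewrite (not_has_exponent H2) ?R2 // (not_has_exponent C2) ?R2 // ifF //.
apply/negbTE/exists_inPn=> x Hx; apply/exists_inPn=> y /CA Ay.
apply/negP=> /andP[nyp /eqP yp].
have [r [a [Aa def_x]]] := Hnf x Hx; pose z := g 1%N ^+ r.
have Hz : z \in H by rewrite groupX.
have commA u : u \in A -> [~ u, z] \in A.
  move=> Au; rewrite commgEl groupM ?groupV // memJ_norm //.
  exact: (subsetP (normal_norm nsAH)).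
have commx u : u \in A -> [~ u, x] = [~ u, z].
  move=> Au; have cua : [~ u, a] = 1 by apply/eqP/commgP/cA.
  by rewrite def_x commgMJ cua mul1g conjgE (cA _ _ (commA u Au) Aa) mulKg.
have commM u v : u \in A -> v \in A -> [~ u * v, z] = [~ u, z] * [~ v, z].
  by move=> Au Av; rewrite commMgJ conjgE (cA _ _ (commA u Au) Av) mulKg.
have commX u n : u \in A -> [~ u ^+ n, z] = [~ u, z] ^+ n.
  by move=> Au; apply: commXg; apply: cA => //; apply: commA.
have [e [z2 z3]] : exists e, [~ g 2, z] = g 3 ^+ r * g 4 ^+ e /\ [~ g 3, z] = g 4 ^+ r.
  have [] := @comm_expg_class3 _ (g 2) (g 1%N) r; rewrite c21 c31.
  - exact/commgP/eqP.
  - exact: cA.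
  by exists 'C(r, 2).
have z4 : [~ g 4, z] = 1 := commg_center Z4 Hz.
have [|t _ [n nfn def_y]] := gen_has_normal_form p_gt1 (y := y) pc2.
  apply: etrans Ay; congr (_ \in <<_>>).
  by apply/setP=> u; rewrite !inE -!orbA.
have [s _ [n' [q _ [_ -> def_n']] def_n]] := nfn.
have ypE : y ^+ p = g 4 ^+ (w * t).
  rewrite def_y expgMn; last by rewrite def_n def_n' mulg1; apply: cA; rewrite ?groupM
    ?groupX.
  rewrite def_n def_n' mulg1 expgMn; last by apply: cA; rewrite groupX.
  by rewrite -!expgnA !(mulnC _ p) !expgnA R2 R3 R4 !expg1n !mulg1.
have yxxE : [~ [~ y, x], x] = g 4 ^+ (r ^ 2 * t).
  have A3s : g 3 ^+ s \in A by rewrite groupX.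
  have A4q : g 4 ^+ q \in A by rewrite groupX.
  have A2t : g 2 ^+ t \in A by rewrite groupX.
  have A4n i : g 4 ^+ i \in A by rewrite groupX.
  have A3rt : g 3 ^+ r ^+ t \in A by rewrite !groupX.
  have A34 : g 3 ^+ s * g 4 ^+ q \in A by rewrite groupM.
  have Dy : [~ y, z] = g 3 ^+ r ^+ t * (g 4 ^+ e ^+ t * g 4 ^+ r ^+ s).
    rewrite def_y def_n def_n' mulg1 (commM _ _ A2t A34) (commM _ _ A3s A4q).
    rewrite !commX // z2 z3 z4 expg1n mulg1 mulgA expgMn //.
    by apply: cA; rewrite groupX.
  have Ae : g 4 ^+ e ^+ t * g 4 ^+ r ^+ s \in A by rewrite groupM ?groupX.
  rewrite (commx _ Ay) (commx _ (commA y Ay)) Dy (commM _ _ A3rt Ae).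
  rewrite commM ?groupX // !commX ?groupX // z3 z4 !expg1n !mulg1.
  by rewrite -!expgnA -mulnn mulnA.
have o4 : #[g 4] = p := order_eq_prime p_pr R4 n4.
have /eqP : g 4 ^+ (w * t) = g 4 ^+ (r ^ 2 * t) by rewrite -ypE yp yxxE.
have p_t : coprime t p.
  rewrite coprime_sym prime_coprime //; apply: contra nyp => /dvdnP[j tE].
  by rewrite ypE tE mulnA mulnC expgnA R4 expg1n.
rewrite eq_expg_mod_order o4 => eq_wt; apply: (nsq r); apply/eqP.
(* t is prime to p since y^p is not trivial. *)
have cancel_t m1 m2 : m1 <= m2 -> m1 * t == m2 * t %[mod p] -> m1 == m2 %[mod p].
  move=> le_m; rewrite eq_sym eqn_mod_dvd ?leq_mul2r ?le_m ?orbT // -mulnBl.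
  by rewrite Gauss_dvdl 1?coprime_sym // -eqn_mod_dvd // eq_sym.
have [le_w | /ltnW le_w] := leqP (r ^ 2) w.
  by apply: cancel_t; rewrite // eq_sym.
by rewrite eq_sym; apply: cancel_t.
Qed.

End IndexOfRelations.

(** * The classification *)

Section Classification.
Variables (p w : nat).
Hypotheses (p_pr : prime p) (p_gt3 : 3 < p).
Let odd_p : odd p. Proof. by case: (even_prime p_pr) p_gt3 => [->|]. Qed.

Lemma classification_exists (gT : finGroupType) (H : {group gT}) :
    (forall n, ~~ (p %| n) ->
       exists r, n = r ^ 2 %[mod p] \/ n = r ^ 2 * w %[mod p]) ->
    #|H| = (p ^ 4)%N ->
  (exists2 k, 1 <= k <= 15 & satisfies p w k H) \/ p.-abelem H.
Proof.
move=> sqr oH; have [abH|nabH] := boolP (abelian H).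
  exact: abelian_exists.
left; have [oZ|oZ] := nonabelian_center p_pr oH nabH.
  exact: maxclass_exists.
exact: class2_exists.
Qed.

Lemma satisfies_index k (gT : finGroupType) (H : {group gT}) :
    (forall r, r ^ 2 <> w %[mod p]) -> #|H| = (p ^ 4)%N ->
  satisfies p w k H -> list_index p H = k.
Proof.
move=> nsq oH [g [defH Rg]].
have [k_ab | nk_ab] := boolP (k \in [:: 1; 2; 5; 11]%N).
  exact: (index_abelian p_pr oH defH Rg).
have [k_c2 | nk_c2] := boolP (k \in [:: 3; 4; 6; 12; 13; 14]%N).
  exact: (index_class2 p_pr p_gt3 oH defH Rg).
apply: (index_maxclass p_pr p_gt3 oH defH nsq Rg).
by move: Rg nk_ab nk_c2; do 15?[case: k => [|k] //].
Qed.

Lemma abelem_index (gT : finGroupType) (H : {group gT}) :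
  p.-abelem H -> list_index p H = 15.
Proof.
case/(abelemP p_pr)=> abH expH; rewrite /list_index abH.
by have /has_exponentP-> : {in H, forall x, x ^+ p = 1} by [].
Qed.

End Classification.

Theorem mainTheorem3 (p : nat) (w : {unit 'F_p}) (p_prime : prime p)
    (p_gt3 : 3 < p) (w_gen : generator [set: {unit 'F_p}] w) :
  exists (gT : nat -> finGroupType) (G : forall k : nat, {group gT k}),
    [/\ forall k, 1 <= k <= 15 -> is_listed p (val (val w)) k (G k),
        [/\ G 1%N \isog Zp (p ^ 4)%N,
            G 2 \isog setX (Zp (p ^ 2)%N) (Zp (p ^ 2)%N)
          & G 5 \isog setX (Zp (p ^ 3)%N) (Zp p)],
        forall k, 1 <= k <= 15 -> #|G k| = (p ^ 4)%N
      & forall (rT : finGroupType) (H : {group rT}), #|H| = (p ^ 4)%N ->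
          exists! k : nat, 1 <= k <= 15 /\ H \isog G k].
Proof.
have odd_p : odd p by case: (even_prime p_prime) p_gt3 => [->|].
set v := val (val w); pose M := listed_model v p_prime odd_p.
exists (fun k => projT1 (M k)), (fun k => projT2 (M k)).
have oM k : #|projT2 (M k)| = (p ^ 4)%N by apply: card_listed_model.
have satM k : 1 <= k <= 14 -> satisfies p v k (projT2 (M k)).
  exact: listed_model_satisfies.
have abelM : p.-abelem (projT2 (M 15)) by apply: listed_model_elementary.
have k15 k : 1 <= k <= 15 -> k != 15 -> 1 <= k <= 14.
  by case/andP=> k_gt0 k_le nk; rewrite k_gt0 -ltnS ltn_neqAle nk.
have nsq r : r ^ 2 <> v %[mod p] by apply: generator_nonsquare => //; apply: ltnW.
split=> [k k_in||k _|rT H oH].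
- rewrite /is_listed; case: eqVneq => [->|nk]; first exact: isog_refl.
  by apply: satisfies_presented => //; apply/satM/k15.
- by split; apply: isog_refl.
- exact: oM.
have indexM k : 1 <= k <= 15 -> H \isog projT2 (M k) -> list_index p H = k.
  move=> k_in isoHM; have [k_eq|nk] := eqVneq k 15.
    by rewrite k_eq in isoHM *; apply: (abelem_index p_prime); rewrite (isog_abelem isoHM).
  apply: (@satisfies_index p v) => //.
  by apply: (isog_satisfies _ (satM k (k15 k k_in nk))); rewrite isog_sym.
have [k [k_in isoHM]] : exists k, 1 <= k <= 15 /\ H \isog projT2 (M k).
  have [n ndvd||[k k_in satH]|abelH] := @classification_exists p v p_prime p_gt3 _ H.
  - exact: square_class.
  - exact: oH.
  - exists k; split=> //; have [k_eq|nk] := eqVneq k 15.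
      by case: satH => g [_]; rewrite k_eq.
    by apply: (satisfies_isog p_prime oH (oM k) satH); apply/satM/k15.
  exists 15; split=> //; rewrite (isog_abelem_card _ abelH) abelM /=.
  by rewrite oH; apply/eqP; apply: (oM 15).
exists k; split=> // k' [k'_in isoHM'].
by rewrite -(indexM k) // -(indexM k').
Qed.
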